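(* Let $\psi$ be an endomorphism of the free Poisson algebra $P=k\{x,y\}$ in the variables $x,y$ over a field $k$ of characteristic $0$. If the Jacobian matrix $J(\psi)$ is invertible over $P^e$ then $\psi(x),\psi(y)\in k[x,y]$.
   Context: A Poisson algebra over $k$ is a commutative associative algebra with identity $1$ endowed with a Lie bracket $\{x,y\}$ such that $\{x,yz\}=\{x,y\}z+y\{x,z\}$. $k\{x,y\}$ is the free Poisson algebra on $x,y$, and $k[x,y]\subset k\{x,y\}$ is the (polynomial) associative subalgebra with identity generated by $x,y$. For a Poisson algebra $P$, the universal enveloping algebra $P^e$ is the associative unital $k$-algebra generated by two copies $m_P=\{m_a: a\in P\}$, $h_P=\{h_a: a\in P\}$ of the vector space $P$ (with $a\mapsto m_a$, $a\mapsto h_a$ linear) subject to the relations, for all $a,b\in P$: $m_{ab}=m_am_b$, $h_{\{a,b\}}=h_ah_b-h_bh_a$, $h_{ab}=m_bh_a+m_ah_b$, $m_{\{a,b\}}=h_am_b-m_bh_a$, $m_1=1$. The map $a\mapsto m_a$ is injective and $m_a$ is identified with $a$. For $P=k\{x_1,\ldots,x_n\}$, the left ideal $\Omega_P$ of $P^e$ generated by $h_{x_1},\ldots,h_{x_n}$ is a free left $P^e$-module with basis $h_{x_1},\ldots,h_{x_n}$ and contains $h_p$ for all $p\in P$. The Fox derivatives $\frac{\partial p}{\partial x_i}\in P^e$ of $p\in P$ are uniquely defined by $h_p=\frac{\partial p}{\partial x_1}h_{x_1}+\cdots+\frac{\partial p}{\partial x_n}h_{x_n}$. For an endomorphism $\psi$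 of the Poisson algebra $P$, the Jacobian matrix is $J(\psi)=[u_{ij}]$ with $u_{ij}=\frac{\partial\psi(x_i)}{\partial x_j}$, $1\le i,j\le n$ (here $n=2$, $x_1=x$, $x_2=y$). *)

(* Defs.v *)
From HB Require Import structures.
From mathcomp Require Import all_boot all_order all_algebra.
From mathcomp.classical Require Import boolp.

Set Implicit Arguments.
Unset Strict Implicit.
Unset Printing Implicit Defensive.

Import GRing.Theory.

Local Open Scope ring_scope.
Local Open Scope quotient_scope.

HB.mixin Record isPoisson (k : fieldType) P of GRing.ComAlgebra k P := {
  pbr : P -> P -> P;
  pbr_linearl : forall z : P, linear (fun x => pbr x z);
  pbr_linearr : forall z : P, linear (fun x => pbr z x);
  pbrxx : forall x : P, pbr x x = 0;
  pbr_jacobi : forall x y z : P,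
    pbr x (pbr y z) + pbr y (pbr z x) + pbr z (pbr x y) = 0;
  pbr_leibniz : forall x y z : P, pbr x (y * z) = pbr x y * z + y * pbr x z;
}.

#[short(type="poissonAlgType")]
HB.structure Definition PoissonAlgebra (k : fieldType) :=
  {P of GRing.ComAlgebra k P & isPoisson k P}.

Definition poisson_morphism (k : fieldType) (P Q : poissonAlgType k)
  (f : P -> Q) : Prop := {morph f : x y / pbr x y}.

Definition zeroPoisson (k : fieldType) : Type := k^o.

Section ZeroPoisson.
Variable k : fieldType.
HB.instance Definition _ := GRing.ComAlgebra.on (zeroPoisson k).
Let br (x y : zeroPoisson k) : zeroPoisson k := 0.
Let br_lin : forall z, linear (br^~ z).
Proof. by move=> z a u v; rewrite /br scaler0 addr0. Qed.
Let br_linr : forall z, linear (br z).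
Proof. by move=> z a u v; rewrite /br scaler0 addr0. Qed.
Let brxx : forall x, br x x = 0. Proof. by []. Qed.
Let br_jac : forall x y z, br x (br y z) + br y (br z x) + br z (br x y) = 0.
Proof. by move=> x y z; rewrite /br !addr0. Qed.
Let br_leib : forall x y z, br x (y * z) = br x y * z + y * br x z.
Proof. by move=> x y z; rewrite /br mul0r mulr0 addr0. Qed.
HB.instance Definition _ :=
  isPoisson.Build k (zeroPoisson k) br_lin br_linr brxx br_jac br_leib.
End ZeroPoisson.

Inductive pterm (k : Type) (n : nat) : Type :=
| PVar of 'I_n
| PCst of k
| PAdd of pterm k n & pterm k n
| PMul of pterm k n & pterm k n
| PBr of pterm k n & pterm k n.
Arguments PVar {k n}.
Arguments PCst {k n}.

HB.instance Definition _ (k : Type) n := gen_eqMixin (pterm k n).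
HB.instance Definition _ (k : Type) n := gen_choiceMixin (pterm k n).

Fixpoint peval (k : fieldType) n (Q : poissonAlgType k) (f : 'I_n -> Q)
    (t : pterm k n) : Q :=
  match t with
  | PVar i => f i
  | PCst c => c%:A
  | PAdd s t => peval f s + peval f t
  | PMul s t => peval f s * peval f t
  | PBr s t => pbr (peval f s) (peval f t)
  end.

(** Two terms are identified when they have the same value for every choice of
    the variables in every Poisson algebra, i.e., when their equality follows
    from the axioms of Poisson algebras. (The types below exclude the zero
    algebra, which imposes no condition here.) *)
Definition pequiv (k : fieldType) n (s t : pterm k n) : bool :=
  `[< forall (Q : poissonAlgType k) (f : 'I_n -> Q), peval f s = peval f t >].

Section FreePoisson.
Variables (k : fieldType) (n : nat).

Lemma pequiv_refl : reflexive (@pequiv k n).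
Proof. by move=> s; apply/asboolP. Qed.

Lemma pequiv_sym : symmetric (@pequiv k n).
Proof. by move=> s t; apply/asboolP/asboolP => + Q f => ->. Qed.

Lemma pequiv_trans : transitive (@pequiv k n).
Proof.
by move=> t s u /asboolP st /asboolP tu; apply/asboolP => Q f; rewrite st tu.
Qed.

Canonical pequiv_equiv :=
  EquivRel (@pequiv k n) pequiv_refl pequiv_sym pequiv_trans.

Definition freePoisson : Type := {eq_quot pequiv_equiv}.

HB.instance Definition _ := Choice.on freePoisson.

Definition fpclass (t : pterm k n) : freePoisson :=
  \pi_({eq_quot pequiv_equiv}) t.

Definition fprepr (p : freePoisson) : pterm k n :=
  repr (p : {eq_quot pequiv_equiv}).

Definition fpeval (Q : poissonAlgType k) (f : 'I_n -> Q) (p : freePoisson) : Q :=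
  peval f (fprepr p).

Lemma fpreprK p : fpclass (fprepr p) = p.
Proof. exact: reprK. Qed.

Lemma fpeval_class Q f t : @fpeval Q f (fpclass t) = peval f t.
Proof.
have /eqmodP/asboolP : fpclass (fprepr (fpclass t)) = fpclass t.
  by rewrite fpreprK.
exact.
Qed.

Lemma fpevalP p q : (forall Q f, @fpeval Q f p = fpeval f q) -> p = q.
Proof.
by move=> E; rewrite -[p]fpreprK -[q]fpreprK; apply/eqmodP/asboolP; apply: E.
Qed.

Definition fpvar (i : 'I_n) : freePoisson := fpclass (PVar i).

Definition fpadd p q := fpclass (PAdd (fprepr p) (fprepr q)).
Definition fpmul p q := fpclass (PMul (fprepr p) (fprepr q)).
Definition fpbr p q := fpclass (PBr (fprepr p) (fprepr q)).
Definition fpscale c p := fpclass (PMul (PCst c) (fprepr p)).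
Definition fpopp p := fpscale (-1) p.
Definition fpzero := fpclass (PCst 0).
Definition fpone := fpclass (PCst 1).

Let fpaddE Q f p q : @fpeval Q f (fpadd p q) = fpeval f p + fpeval f q.
Proof. by rewrite fpeval_class. Qed.
Let fpmulE Q f p q : @fpeval Q f (fpmul p q) = fpeval f p * fpeval f q.
Proof. by rewrite fpeval_class. Qed.
Let fpbrE Q f p q : @fpeval Q f (fpbr p q) = pbr (fpeval f p) (fpeval f q).
Proof. by rewrite fpeval_class. Qed.
Let fpscaleE Q f c p : @fpeval Q f (fpscale c p) = c *: fpeval f p.
Proof. by rewrite fpeval_class /= mulr_algl. Qed.
Let fpoppE Q f p : @fpeval Q f (fpopp p) = - fpeval f p.
Proof. by rewrite fpscaleE scaleN1r. Qed.
Let fpzeroE Q f : @fpeval Q f fpzero = 0.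
Proof. by rewrite fpeval_class /= scale0r. Qed.
Let fponeE Q f : @fpeval Q f fpone = 1.
Proof. by rewrite fpeval_class /= scale1r. Qed.
Let fpE :=
  (fpaddE, fpmulE, fpbrE, fpoppE, fpscaleE, fpzeroE, fponeE).

Fact fpaddA : associative fpadd.
Proof. by move=> p q r; apply: fpevalP => Q f; rewrite !fpE addrA. Qed.
Fact fpaddC : commutative fpadd.
Proof. by move=> p q; apply: fpevalP => Q f; rewrite !fpE addrC. Qed.
Fact fpadd0 : left_id fpzero fpadd.
Proof. by move=> p; apply: fpevalP => Q f; rewrite !fpE add0r. Qed.
Fact fpaddN : left_inverse fpzero fpopp fpadd.
Proof. by move=> p; apply: fpevalP => Q f; rewrite !fpE addNr. Qed.

HB.instance Definition _ :=
  GRing.isZmodule.Build freePoisson fpaddA fpaddC fpadd0 fpaddN.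

Fact fpmulA : associative fpmul.
Proof. by move=> p q r; apply: fpevalP => Q f; rewrite !fpE mulrA. Qed.
Fact fpmulC : commutative fpmul.
Proof. by move=> p q; apply: fpevalP => Q f; rewrite !fpE mulrC. Qed.
Fact fpmul1 : left_id fpone fpmul.
Proof. by move=> p; apply: fpevalP => Q f; rewrite !fpE mul1r. Qed.
Fact fpmulDl : left_distributive fpmul fpadd.
Proof. by move=> p q r; apply: fpevalP => Q f; rewrite !fpE mulrDl. Qed.
Fact fpone_neq0 : fpone != fpzero.
Proof.
apply/eqP => /(congr1 (@fpeval (zeroPoisson k) (fun=> 0))).
by rewrite !fpE => /eqP; rewrite oner_eq0.
Qed.

HB.instance Definition _ := GRing.Zmodule_isComNzRing.Build freePoisson
  fpmulA fpmulC fpmul1 fpmulDl fpone_neq0.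

Fact fpscaleA a b p : fpscale a (fpscale b p) = fpscale (a * b) p.
Proof. by apply: fpevalP => Q f; rewrite !fpE scalerA. Qed.
Fact fpscale1 : left_id 1 fpscale.
Proof. by move=> p; apply: fpevalP => Q f; rewrite !fpE scale1r. Qed.
Fact fpscaleDr : right_distributive fpscale +%R.
Proof. by move=> a p q; apply: fpevalP => Q f; rewrite !fpE scalerDr. Qed.
Fact fpscaleDl p : {morph fpscale^~ p : a b / a + b}.
Proof. by move=> a b; apply: fpevalP => Q f; rewrite !fpE scalerDl. Qed.

HB.instance Definition _ := GRing.Zmodule_isLmodule.Build k freePoisson
  fpscaleA fpscale1 fpscaleDr fpscaleDl.

Fact fpscaleAl (a : k) (p q : freePoisson) : a *: (p * q) = (a *: p) * q.
Proof. by apply: fpevalP => Q f; rewrite !fpE scalerAl. Qed.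

HB.instance Definition _ :=
  GRing.Lmodule_isLalgebra.Build k freePoisson fpscaleAl.
HB.instance Definition _ := GRing.Lalgebra_isComAlgebra.Build k freePoisson.

Fact fpbr_linearl p : linear (fpbr^~ p).
Proof.
by move=> a q r; apply: fpevalP => Q f; rewrite !fpE (pbr_linearl (fpeval f p)).
Qed.
Fact fpbr_linearr p : linear (fpbr p).
Proof.
by move=> a q r; apply: fpevalP => Q f; rewrite !fpE (pbr_linearr (fpeval f p)).
Qed.
Fact fpbrxx p : fpbr p p = 0.
Proof. by apply: fpevalP => Q f; rewrite !fpE pbrxx. Qed.
Fact fpbr_jacobi (p q r : freePoisson) :
  fpbr p (fpbr q r) + fpbr q (fpbr r p) + fpbr r (fpbr p q) = 0.
Proof. by apply: fpevalP => Q f; rewrite !fpE pbr_jacobi. Qed.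
Fact fpbr_leibniz (p q r : freePoisson) :
  fpbr p (q * r) = fpbr p q * r + q * fpbr p r.
Proof. by apply: fpevalP => Q f; rewrite !fpE pbr_leibniz. Qed.

HB.instance Definition _ := isPoisson.Build k freePoisson
  fpbr_linearl fpbr_linearr fpbrxx fpbr_jacobi fpbr_leibniz.

Section Universal.
Variables (Q : poissonAlgType k) (f : 'I_n -> Q).

Fact fpeval_linear : linear (fpeval f).
Proof. by move=> a p q; rewrite !fpE. Qed.
Fact fpeval_monoid : monoid_morphism (fpeval f).
Proof. by split=> [|p q]; rewrite !fpE. Qed.

HB.instance Definition _ :=
  GRing.isLinear.Build k freePoisson Q _ (fpeval f) fpeval_linear.
HB.instance Definition _ :=
  GRing.isMonoidMorphism.Build freePoisson Q (fpeval f) fpeval_monoid.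

Lemma fpeval_poisson : poisson_morphism (fpeval f).
Proof. by move=> p q; rewrite !fpE. Qed.

Lemma fpeval_var i : fpeval f (fpvar i) = f i.
Proof. by rewrite fpeval_class. Qed.

End Universal.

Lemma freePoisson_ind (S : freePoisson -> Prop) :
  (forall i, S (fpvar i)) -> (forall c, S c%:A) ->
  (forall p q, S p -> S q -> S (p + q)) ->
  (forall p q, S p -> S q -> S (p * q)) ->
  (forall p q, S p -> S q -> S (pbr p q)) -> forall p, S p.
Proof.
move=> SV SC SD SM SB p; rewrite -[p]fpreprK.
elim: (fprepr p) => {p} [i|c|s Ss t St|s Ss t St|s Ss t St]; first exact: SV.
- suff ->: fpclass (PCst c) = c%:A by [].
  by apply: fpevalP => Q f; rewrite !fpE fpeval_class.
- suff ->: fpclass (PAdd s t) = fpclass s + fpclass t by apply: SD.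
  by apply: fpevalP => Q f; rewrite !fpE !fpeval_class.
- suff ->: fpclass (PMul s t) = fpclass s * fpclass t by apply: SM.
  by apply: fpevalP => Q f; rewrite !fpE !fpeval_class.
- suff ->: fpclass (PBr s t) = pbr (fpclass s) (fpclass t) by apply: SB.
  by apply: fpevalP => Q f; rewrite !fpE !fpeval_class.
Qed.

Lemma fpeval_unique (Q : poissonAlgType k) (f : 'I_n -> Q)
    (g : {lrmorphism freePoisson -> Q}) :
  poisson_morphism g -> (forall i, g (fpvar i) = f i) -> g =1 fpeval f.
Proof.
move=> gB gV; elim/freePoisson_ind => [i|c|p q Ep Eq|p q Ep Eq|p q Ep Eq].
- by rewrite gV fpeval_var.
- by rewrite !linearZ /= !rmorph1.
- by rewrite !raddfD /= Ep Eq.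
- by rewrite !rmorphM /= Ep Eq.
- by rewrite gB fpeval_poisson Ep Eq.
Qed.

End FreePoisson.

Arguments fpvar k {n} i.

(** The associative subalgebra with identity generated by the variables. *)
Definition in_polynomials (k : fieldType) n (p : freePoisson k n) : Prop :=
  forall S : {pred freePoisson k n}, GRing.subalg_closed S ->
    (forall i, fpvar k i \in S) -> p \in S.

Record env_relations (k : fieldType) (P : poissonAlgType k) (A : algType k)
    (m h : P -> A) : Prop := EnvRelations {
  env_m_linear : linear m;
  env_h_linear : linear h;
  env_mM : forall a b, m (a * b) = m a * m b;
  env_hB : forall a b, h (pbr a b) = h a * h b - h b * h a;
  env_hM : forall a b, h (a * b) = m b * h a + m a * h b;
  env_mB : forall a b, m (pbr a b) = h a * m b - m b * h a;
  env_m1 : m 1 = 1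
}.

Inductive uterm (k P : Type) : Type :=
| UM of P
| UH of P
| UCst of k
| UAdd of uterm k P & uterm k P
| UMul of uterm k P & uterm k P.
Arguments UM {k P}.
Arguments UH {k P}.
Arguments UCst {k P}.

HB.instance Definition _ (k P : Type) := gen_eqMixin (uterm k P).
HB.instance Definition _ (k P : Type) := gen_choiceMixin (uterm k P).

Fixpoint ueval (k : fieldType) (P : Type) (A : algType k) (m h : P -> A)
    (t : uterm k P) : A :=
  match t with
  | UM a => m a
  | UH a => h a
  | UCst c => c%:A
  | UAdd s t => ueval m h s + ueval m h t
  | UMul s t => ueval m h s * ueval m h t
  end.

(** Two terms are identified when they have the same value in every associative
    algebra with elements [m_a], [h_a] satisfying the defining relations. *)
Definition uequiv (k : fieldType) (P : poissonAlgType k) (s t : uterm k P) :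
    bool :=
  `[< forall (A : algType k) (m h : P -> A), env_relations m h ->
        ueval m h s = ueval m h t >].

(** The algebra of linear endomorphisms of [P] and the action of [P] on itself
    given by [m_a p = a * p] and [h_a p = pbr a p]; they show that the enveloping
    algebra is nonzero and that [m] is injective. *)
Section Action.
Variables (k : fieldType) (P : poissonAlgType k).

Record lend := Lend { lend_fun :> P -> P; lendP : linear lend_fun }.

Lemma lend_ext (f g : lend) : f =1 g -> f = g.
Proof.
case: f g => [f fP] [g gP] /= /funext E.
by move: gP; rewrite -E => gP; congr Lend; apply: Prop_irrelevance.
Qed.

HB.instance Definition _ := gen_eqMixin lend.
HB.instance Definition _ := gen_choiceMixin lend.

Implicit Types f g : lend.

Let ladd_subproof f g : linear (fun p => f p + g p).
Proof. by move=> a p q; rewrite !lendP scalerDr addrACA. Qed.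
Let lopp_subproof f : linear (fun p => - f p).
Proof. by move=> a p q; rewrite !lendP opprD scalerN. Qed.
Let lzero_subproof : linear (fun _ : P => 0 : P).
Proof. by move=> a p q; rewrite scaler0 addr0. Qed.
Let lscale_subproof c f : linear (fun p => c *: f p).
Proof. by move=> a p q; rewrite !lendP scalerDr !scalerA mulrC. Qed.
Let lmul_subproof f g : linear (fun p => f (g p)).
Proof. by move=> a p q; rewrite !lendP. Qed.
Let lone_subproof : linear (fun p : P => p).
Proof. by []. Qed.

Definition ladd f g := Lend (ladd_subproof f g).
Definition lopp f := Lend (lopp_subproof f).
Definition lzero := Lend lzero_subproof.
Definition lscale c f := Lend (lscale_subproof c f).
Definition lmul f g := Lend (lmul_subproof f g).
Definition lone := Lend lone_subproof.

Let lendD f p q : f (p + q) = f p + f q.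
Proof. by rewrite -[p]scale1r lendP !scale1r. Qed.
Let lend0 f : f 0 = 0.
Proof. by apply: (addrI (f 0)); rewrite -lendD !addr0. Qed.
Let lendZ f a p : f (a *: p) = a *: f p.
Proof. by rewrite -[a *: p]addr0 lendP lend0 addr0. Qed.

Fact laddA : associative ladd.
Proof. by move=> f g e; apply: lend_ext => p /=; rewrite addrA. Qed.
Fact laddC : commutative ladd.
Proof. by move=> f g; apply: lend_ext => p /=; rewrite addrC. Qed.
Fact ladd0 : left_id lzero ladd.
Proof. by move=> f; apply: lend_ext => p /=; rewrite add0r. Qed.
Fact laddN : left_inverse lzero lopp ladd.
Proof. by move=> f; apply: lend_ext => p /=; rewrite addNr. Qed.
HB.instance Definition _ := GRing.isZmodule.Build lend laddA laddC ladd0 laddN.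

Fact lmulA : associative lmul. Proof. by move=> f g e; apply: lend_ext. Qed.
Fact lmul1 : left_id lone lmul. Proof. by move=> f; apply: lend_ext. Qed.
Fact lmulr1 : right_id lone lmul. Proof. by move=> f; apply: lend_ext. Qed.
Fact lmulDl : left_distributive lmul ladd.
Proof. by move=> f g e; apply: lend_ext. Qed.
Fact lmulDr : right_distributive lmul ladd.
Proof. by move=> f g e; apply: lend_ext => p /=; rewrite lendD. Qed.
Fact lone_neq0 : lone != lzero.
Proof.
by apply/eqP => /(congr1 (fun f : lend => f 1))/eqP /=; rewrite oner_eq0.
Qed.
HB.instance Definition _ := GRing.Zmodule_isNzRing.Build lend
  lmulA lmul1 lmulr1 lmulDl lmulDr lone_neq0.

Fact lscaleA a b f : lscale a (lscale b f) = lscale (a * b) f.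
Proof. by apply: lend_ext => p /=; rewrite scalerA. Qed.
Fact lscale1 : left_id 1 lscale.
Proof. by move=> f; apply: lend_ext => p /=; rewrite scale1r. Qed.
Fact lscaleDr : right_distributive lscale +%R.
Proof. by move=> a f g; apply: lend_ext => p /=; rewrite scalerDr. Qed.
Fact lscaleDl f : {morph lscale^~ f : a b / a + b}.
Proof. by move=> a b; apply: lend_ext => p /=; rewrite scalerDl. Qed.
HB.instance Definition _ := GRing.Zmodule_isLmodule.Build k lend
  lscaleA lscale1 lscaleDr lscaleDl.
Fact lscaleAl (a : k) (f g : lend) : a *: (f * g) = (a *: f) * g.
Proof. exact: lend_ext. Qed.
HB.instance Definition _ := GRing.Lmodule_isLalgebra.Build k lend lscaleAl.
Fact lscaleAr (a : k) (f g : lend) : a *: (f * g) = f * (a *: g).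
Proof. by apply: lend_ext => p /=; rewrite lendZ. Qed.
HB.instance Definition _ := GRing.Lalgebra_isAlgebra.Build k lend lscaleAr.

Fact lmult_subproof (a : P) : linear (fun p => a * p).
Proof. by move=> c p q; rewrite mulrDr scalerAr. Qed.
Definition lmult a : lend := Lend (lmult_subproof a).
Definition lham a : lend := Lend (pbr_linearr a).

Lemma pbrDl (x y z : P) : pbr (x + y) z = pbr x z + pbr y z.
Proof. by rewrite -[x]scale1r (pbr_linearl z) !scale1r. Qed.
Lemma pbrDr (x y z : P) : pbr x (y + z) = pbr x y + pbr x z.
Proof. exact: (lendD (lham x)). Qed.
Lemma pbrNr (x y : P) : pbr x (- y) = - pbr x y.
Proof. by rewrite -!scaleN1r; apply: (lendZ (lham x)). Qed.
Lemma pbrC (x y : P) : pbr x y = - pbr y x.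
Proof.
apply/eqP; rewrite -addr_eq0; apply/eqP.
by move: (pbrxx (x + y)); rewrite pbrDl !pbrDr !pbrxx add0r addr0.
Qed.

Lemma action_relations : env_relations lmult lham.
Proof.
split.
- by move=> c a b; apply: lend_ext => p /=; rewrite mulrDl scalerAl.
- by move=> c a b; apply: lend_ext => p /=; rewrite (pbr_linearl p).
- by move=> a b; apply: lend_ext => p /=; rewrite mulrA.
- move=> a b; apply: lend_ext => p /=; apply/eqP.
  have := pbr_jacobi a b p.
  rewrite [pbr p (pbr a b)]pbrC [pbr p a]pbrC pbrNr => /eqP.
  by rewrite subr_eq0 => /eqP ->.
- move=> a b; apply: lend_ext => p /=.
  rewrite [LHS]pbrC pbr_leibniz opprD [pbr a p]pbrC [pbr b p]pbrC.
  by rewrite !mulrN [b * _]mulrC.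
- move=> a b; apply: lend_ext => p /=.
  by rewrite pbr_leibniz addrK.
- by apply: lend_ext => p /=; rewrite mul1r.
Qed.

End Action.

Section Envelope.
Variables (k : fieldType) (P : poissonAlgType k).

Lemma uequiv_refl : reflexive (@uequiv k P).
Proof. by move=> s; apply/asboolP. Qed.

Lemma uequiv_sym : symmetric (@uequiv k P).
Proof. by move=> s t; apply/asboolP/asboolP => E A m h /E ->. Qed.

Lemma uequiv_trans : transitive (@uequiv k P).
Proof.
move=> t s u /asboolP st /asboolP tu; apply/asboolP => A m h mh.
by rewrite st ?tu.
Qed.

Canonical uequiv_equiv :=
  EquivRel (@uequiv k P) uequiv_refl uequiv_sym uequiv_trans.

Definition envelope : Type := {eq_quot uequiv_equiv}.

HB.instance Definition _ := Choice.on envelope.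

Definition uclass (t : uterm k P) : envelope := \pi_({eq_quot uequiv_equiv}) t.

Definition urepr (u : envelope) : uterm k P :=
  repr (u : {eq_quot uequiv_equiv}).

Definition eeval (A : algType k) (m h : P -> A) (u : envelope) : A :=
  ueval m h (urepr u).

Lemma ureprK u : uclass (urepr u) = u.
Proof. exact: reprK. Qed.

Lemma eeval_class (A : algType k) (m h : P -> A) t :
  env_relations m h -> eeval m h (uclass t) = ueval m h t.
Proof.
move=> mh; have /eqmodP/asboolP : uclass (urepr (uclass t)) = uclass t.
  by rewrite ureprK.
by apply.
Qed.

Lemma eevalP u v :
  (forall (A : algType k) (m h : P -> A), env_relations m h ->
     eeval m h u = eeval m h v) -> u = v.
Proof.
by move=> E; rewrite -[u]ureprK -[v]ureprK; apply/eqmodP/asboolP; apply: E.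
Qed.

Definition env_m (a : P) : envelope := uclass (UM a).
Definition env_h (a : P) : envelope := uclass (UH a).

Definition eadd u v := uclass (UAdd (urepr u) (urepr v)).
Definition emul u v := uclass (UMul (urepr u) (urepr v)).
Definition escale c u := uclass (UMul (UCst c) (urepr u)).
Definition eopp u := escale (-1) u.
Definition ezero := uclass (UCst 0).
Definition eone := uclass (UCst 1).

Section Eval.
Variables (A : algType k) (m h : P -> A).
Hypothesis mh : env_relations m h.
Let eaddE u v : eeval m h (eadd u v) = eeval m h u + eeval m h v.
Proof. by rewrite eeval_class. Qed.
Let emulE u v : eeval m h (emul u v) = eeval m h u * eeval m h v.
Proof. by rewrite eeval_class. Qed.
Let escaleE c u : eeval m h (escale c u) = c *: eeval m h u.
Proof. by rewrite eeval_class //= mulr_algl. Qed.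
Let eoppE u : eeval m h (eopp u) = - eeval m h u.
Proof. by rewrite escaleE scaleN1r. Qed.
Let ezeroE : eeval m h ezero = 0.
Proof. by rewrite eeval_class //= scale0r. Qed.
Let eoneE : eeval m h eone = 1.
Proof. by rewrite eeval_class //= scale1r. Qed.
Lemma eeval_m a : eeval m h (env_m a) = m a.
Proof. by rewrite eeval_class. Qed.
Lemma eeval_h a : eeval m h (env_h a) = h a.
Proof. by rewrite eeval_class. Qed.
Definition eevalE :=
  (eaddE, emulE, eoppE, escaleE, ezeroE, eoneE, eeval_m, eeval_h).
End Eval.

Fact eaddA : associative eadd.
Proof. by move=> u v w; apply: eevalP => A m h mh; rewrite !(eevalE mh) addrA. Qed.
Fact eaddC : commutative eadd.
Proof. by move=> u v; apply: eevalP => A m h mh; rewrite !(eevalE mh) addrC. Qed.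
Fact eadd0 : left_id ezero eadd.
Proof. by move=> u; apply: eevalP => A m h mh; rewrite !(eevalE mh) add0r. Qed.
Fact eaddN : left_inverse ezero eopp eadd.
Proof. by move=> u; apply: eevalP => A m h mh; rewrite !(eevalE mh) addNr. Qed.

HB.instance Definition _ :=
  GRing.isZmodule.Build envelope eaddA eaddC eadd0 eaddN.

Fact emulA : associative emul.
Proof. by move=> u v w; apply: eevalP => A m h mh; rewrite !(eevalE mh) mulrA. Qed.
Fact emul1 : left_id eone emul.
Proof. by move=> u; apply: eevalP => A m h mh; rewrite !(eevalE mh) mul1r. Qed.
Fact emulr1 : right_id eone emul.
Proof. by move=> u; apply: eevalP => A m h mh; rewrite !(eevalE mh) mulr1. Qed.
Fact emulDl : left_distributive emul eadd.
Proof. by move=> u v w; apply: eevalP => A m h mh; rewrite !(eevalE mh) mulrDl. Qed.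
Fact emulDr : right_distributive emul eadd.
Proof. by move=> u v w; apply: eevalP => A m h mh; rewrite !(eevalE mh) mulrDr. Qed.
Fact eone_neq0 : eone != ezero.
Proof.
apply/eqP => /(congr1 (eeval (@lmult k P) (@lham k P)))/eqP.
by rewrite !(eevalE (action_relations P)) oner_eq0.
Qed.

HB.instance Definition _ := GRing.Zmodule_isNzRing.Build envelope
  emulA emul1 emulr1 emulDl emulDr eone_neq0.

Fact escaleA a b u : escale a (escale b u) = escale (a * b) u.
Proof. by apply: eevalP => A m h mh; rewrite !(eevalE mh) scalerA. Qed.
Fact escale1 : left_id 1 escale.
Proof. by move=> u; apply: eevalP => A m h mh; rewrite !(eevalE mh) scale1r. Qed.
Fact escaleDr : right_distributive escale +%R.
Proof. by move=> a u v; apply: eevalP => A m h mh; rewrite !(eevalE mh) scalerDr. Qed.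
Fact escaleDl u : {morph escale^~ u : a b / a + b}.
Proof. by move=> a b; apply: eevalP => A m h mh; rewrite !(eevalE mh) scalerDl. Qed.

HB.instance Definition _ := GRing.Zmodule_isLmodule.Build k envelope
  escaleA escale1 escaleDr escaleDl.

Fact escaleAl (a : k) (u v : envelope) : a *: (u * v) = (a *: u) * v.
Proof. by apply: eevalP => A m h mh; rewrite !(eevalE mh) scalerAl. Qed.
HB.instance Definition _ := GRing.Lmodule_isLalgebra.Build k envelope escaleAl.
Fact escaleAr (a : k) (u v : envelope) : a *: (u * v) = u * (a *: v).
Proof. by apply: eevalP => A m h mh; rewrite !(eevalE mh) scalerAr. Qed.
HB.instance Definition _ := GRing.Lalgebra_isAlgebra.Build k envelope escaleAr.

Lemma envelope_relations : env_relations env_m env_h.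
Proof.
split=> [c a b|c a b|a b|a b|a b|a b|]; apply: eevalP => A m h mh;
  rewrite !(eevalE mh).
- exact: env_m_linear mh _ _ _.
- exact: env_h_linear mh _ _ _.
- exact: env_mM mh _ _.
- exact: env_hB mh _ _.
- exact: env_hM mh _ _.
- exact: env_mB mh _ _.
- exact: env_m1 mh.
Qed.

Lemma env_m_inj : injective env_m.
Proof.
move=> a b /(congr1 (eeval (@lmult k P) (@lham k P))).
rewrite !(eevalE (action_relations P)).
by move=> /(congr1 (fun f : lend P => f 1)) /=; rewrite !mulr1.
Qed.

Lemma eeval_universal (A : algType k) (m h : P -> A) : env_relations m h ->
  [/\ linear (eeval m h), monoid_morphism (eeval m h),
      (forall a, eeval m h (env_m a) = m a) &
      (forall a, eeval m h (env_h a) = h a)].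
Proof.
by move=> mh; split=> [c u v||a|a]; rewrite ?(eevalE mh) //;
  split=> [|u v]; rewrite ?(eevalE mh).
Qed.

Lemma envelope_ind (S : envelope -> Prop) :
  (forall a, S (env_m a)) -> (forall a, S (env_h a)) -> (forall c, S c%:A) ->
  (forall u v, S u -> S v -> S (u + v)) ->
  (forall u v, S u -> S v -> S (u * v)) -> forall u, S u.
Proof.
move=> Sm Sh SC SD SM u; rewrite -[u]ureprK.
elim: (urepr u) => {u} [a|a|c|s Ss t St|s Ss t St]; [exact: Sm|exact: Sh|..].
- suff ->: uclass (UCst c) = c%:A by [].
  by apply: eevalP => A m h mh; rewrite !(eevalE mh) eeval_class.
- suff ->: uclass (UAdd s t) = uclass s + uclass t by apply: SD.
  by apply: eevalP => A m h mh; rewrite !(eevalE mh) !eeval_class.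
- suff ->: uclass (UMul s t) = uclass s * uclass t by apply: SM.
  by apply: eevalP => A m h mh; rewrite !(eevalE mh) !eeval_class.
Qed.

Lemma eeval_unique (A : algType k) (m h : P -> A)
    (g : {lrmorphism envelope -> A}) : env_relations m h ->
  (forall a, g (env_m a) = m a) -> (forall a, g (env_h a) = h a) ->
  g =1 eeval m h.
Proof.
move=> mh gm gh; elim/envelope_ind => [a|a|c|u v Eu Ev|u v Eu Ev].
- by rewrite gm (eevalE mh).
- by rewrite gh (eevalE mh).
- by rewrite linearZ /= rmorph1 !(eevalE mh).
- by rewrite raddfD /= (eevalE mh) Eu Ev.
- by rewrite rmorphM /= (eevalE mh) Eu Ev.
Qed.

End Envelope.

Arguments env_m {k P} a.
Arguments env_h {k P} a.

Section Fox.
Variables (k : fieldType) (n : nat).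
Let P := freePoisson k n.

Lemma fox_exists (p : P) : exists u : 'I_n -> envelope P,
  env_h p = \sum_(i < n) u i * env_h (fpvar k i).
Proof.
have R := envelope_relations P.
have h1 : env_h (1 : P) = 0.
  have := env_hM R 1 1; rewrite mulr1 (env_m1 R) mul1r => /esym/eqP.
  by rewrite -subr_eq0 addrK => /eqP.
elim/freePoisson_ind: p => [i|c|p q [u Eu] [v Ev]|p q [u Eu] [v Ev]|p q [u Eu] [v Ev]].
- exists (fun j => (j == i)%:R); rewrite (bigD1 i) //= eqxx mul1r big1 ?addr0 //.
  by move=> j /negbTE ->; rewrite mul0r.
- exists (fun=> 0); rewrite big1 => [|i _]; last by rewrite mul0r.
  have := env_h_linear R c 1 (- (c *: 1)); rewrite subrr => E.
  have h0 : env_h (0 : P) = 0.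
    have := env_hM R 0 0; rewrite mulr0 => ->.
    have := env_m_linear R (-1) 0 0; rewrite scaleN1r oppr0 addr0.
    by rewrite scaleN1r addNr => ->; rewrite mul0r addr0.
  have := env_h_linear R c 1 0; rewrite addr0 => ->.
  by rewrite h1 h0 scaler0 addr0.
- exists (fun i => u i + v i).
  have := env_h_linear R 1 p q; rewrite !scale1r => ->.
  by rewrite Eu Ev -big_split /=; apply: eq_bigr => i _; rewrite mulrDl.
- exists (fun i => env_m q * u i + env_m p * v i).
  rewrite (env_hM R) Eu Ev !mulr_sumr -big_split /=.
  by apply: eq_bigr => i _; rewrite mulrDl !mulrA.
- exists (fun i => env_h p * v i - env_h q * u i).
  rewrite (env_hB R) [X in _ * X - _]Ev [X in _ - _ * X]Eu !mulr_sumr -sumrB.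
  by apply: eq_bigr => i _; rewrite mulrBl !mulrA.
Qed.

(** The coordinates of [h_p] on the basis [h_(x_i)] of the left ideal that these
    elements generate. This left ideal is a free left module on them (not proved
    here), so the chosen family is the only one satisfying [foxP]. *)
Definition fox (p : P) : 'I_n -> envelope P := sval (cid (fox_exists p)).

Lemma foxP (p : P) : env_h p = \sum_(i < n) fox p i * env_h (fpvar k i).
Proof. exact: svalP (cid (fox_exists p)). Qed.

Definition jacobian (psi : P -> P) : 'M[envelope P]_n :=
  \matrix_(i, j) fox (psi (fpvar k i)) j.

End Fox.

(** [unitmx] is only available over commutative rings. *)
Definition invertible_mx (R : nzRingType) n (A : 'M[R]_n) : Prop :=
  exists B : 'M[R]_n, A *m B = 1%:M /\ B *m A = 1%:M.

(* Main.v *)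
Require Import Defs.
From HB Require Import structures.
From mathcomp Require Import all_boot all_order all_algebra finmap.
From mathcomp.classical Require Import boolp.
From mathcomp.multinomials Require Import monalg.
From mathcomp Require Import ring zify.

(** Let [S] be the symmetric algebra of the free associative algebra, with its
    Lie-Poisson bracket. The free Poisson algebra [P] embeds into [S]; in
    characteristic zero, right-normed bracketing of words, divided by the
    length, induces a retraction. The enveloping algebra acts on
    [S]-valued functions of words by operators [H_w] with coefficients in [S],
    and the leading symbols of these operators multiply as in the free
    associative algebra over [S]. In this picture [h_p] becomes the
    noncommutative gradient of [p], each homogeneous component of which is a Lie
    element over [S]; its degree is at most one exactly if [p] is a polynomial.

    A left inverse of the Jacobian matrix expresses the letters as left
    combinations of the gradients [F0], [F1] of the two images. If one of them
    has degree at least two, comparing degrees shows that the leading forms are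
    left dependent. In a free associative algebra one of them is then, up to
    scalars, a left multiple [e g] of the other one [g]. A primitive element is
    never of this form with [e] of positive degree, so the leading forms are
    proportional over [S]. Replacing [F0] by the combination of [F0], [F1]
    in which they cancel lowers its degree and leaves independent leading forms,
    a contradiction. *)

Set Implicit Arguments.
Unset Strict Implicit.
Unset Printing Implicit Defensive.

Import GRing.Theory.
Local Open Scope ring_scope.

(** * Polynomial rings and their derivations *)

(** The polynomial ring, known only through evaluation and induction. An evaluation carries its own
    morphism of coefficients, so that targets such as [{poly cpoly}] need no structure of
    [k]-algebra. *)
Record free_comalg (k : fieldType) (V : Type) : Type := FreeComalg {
  fc_sort : comAlgType k;
  fc_var : V -> fc_sort;
  fc_eval : forall B : comNzRingType, {rmorphism k -> B} -> (V -> B) ->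
    {rmorphism fc_sort -> B};
  fc_eval_var : forall B f g v, @fc_eval B f g (fc_var v) = g v;
  fc_eval_const : forall B f g c, @fc_eval B f g c%:A = f c;
  fc_ind : forall S : fc_sort -> Prop,
    (forall v, S (fc_var v)) -> (forall c, S c%:A) ->
    (forall p q, S p -> S q -> S (p + q)) ->
    (forall p q, S p -> S q -> S (p * q)) -> forall p, S p }.

Section MonoidAlgebra.
Variables (k : fieldType) (V : choiceType).

Local Notation malg_cm := {malg k[{cmonom V}]}.

Let malg_var (v : V) : malg_cm := mkmalgU (ucm v) 1.

Section Eval.
Variables (B : comNzRingType) (f : {rmorphism k -> B}) (g : V -> B).

Definition cmeval (m : {cmonom V}) : B := \prod_(v <- finsupp m) g v ^+ m v.

Lemma cmevalEw (m : {cmonom V}) (d : {fset V}) : (finsupp m `<=` d)%fset ->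
  cmeval m = \prod_(v <- d) g v ^+ m v.
Proof.
move=> le; rewrite /cmeval (big_fset_incl _ le) //= => v _.
by rewrite -cmE_eq0 => /eqP ->; rewrite expr0.
Qed.

Lemma cmeval_mmorphism : mmorphism cmeval.
Proof.
split=> [m1 m2|]; last by rewrite /cmeval mdom1 big_seq_fset0.
rewrite (@cmevalEw m1 (finsupp m1 `|` finsupp m2)%fset) ?fsubsetUl //.
rewrite (@cmevalEw m2 (finsupp m1 `|` finsupp m2)%fset) ?fsubsetUr //.
rewrite (@cmevalEw (mul m1 m2) (finsupp m1 `|` finsupp m2)%fset) ?mdomD //.
by rewrite -big_split /=; apply: eq_bigr => v _; rewrite cmM exprD.
Qed.
HB.instance Definition _ := isMultiplicative.Build _ _ cmeval cmeval_mmorphism.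

Definition mmeval : malg_cm -> B := mmap f cmeval.
HB.instance Definition _ := GRing.RMorphism.on mmeval.

Lemma mmeval_var v : mmeval (malg_var v) = g v.
Proof.
by rewrite /mmeval mmapU /= rmorph1 mul1r /cmeval mdomU big_seq_fset1 ucmE eqxx.
Qed.

Lemma mmeval_const c : mmeval c%:A = f c.
Proof. by rewrite /mmeval mmapZ /= mmap1 mulr1. Qed.

End Eval.


Let malg_ind (S : malg_cm -> Prop) :
  (forall v, S (malg_var v)) -> (forall c, S c%:A) ->
  (forall p q, S p -> S q -> S (p + q)) ->
  (forall p q, S p -> S q -> S (p * q)) -> forall p, S p.
Proof.
move=> SV SC SD SM p; have S0 : S 0 by rewrite -(scale0r 1); apply: SC.
have Smon (m : {cmonom V}) : S (mkmalgU m 1).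
  elim: {m}(mdeg m) {-2}m (erefl (mdeg m)) => [|d IH] m dm.
    by rewrite (mdeg_eq0I dm) -[mkmalgU _ _]scale1r; apply: SC.
  have [v vm]: exists v, v \in finsupp m.
    have [v vm|] := pickP (fun v : finsupp m => true).
      by exists (val v); apply: valP.
    move=> nov; suff: mdeg m = 0%N by rewrite dm.
    by rewrite mdegE big_seq big1 // => v vm; have := nov [` vm]%fset.
  have E : m = mul (ucm v) (divcm m (ucm v)).
    apply/eqP/cmP => u; rewrite cmM divcmE !ucmE.
    case: eqP => [<-|_]; last by rewrite subn0.
    by rewrite subnKC // lt0n cmE_neq0.
  have malgUM (m1 m2 : {cmonom V}) : mkmalgU (mul m1 m2) 1 =
      (mkmalgU m1 1 : malg_cm) * mkmalgU m2 1.
    by rewrite [RHS]malgM_def fgmulUU mulr1.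
  rewrite E malgUM; apply: SM (SV v) _.
  by apply: IH; apply: succn_inj; rewrite -dm {2}E mdegM mdegU.
have SZ (c : k) (q : malg_cm) : S q -> S (c *: q).
  by move=> Sq; rewrite -mulr_algl; apply: (SM _ _ (SC c) Sq).
rewrite [p]monalgE; elim: (msupp p : seq _) => [|m s IH].
  by rewrite big_nil; apply: S0.
rewrite big_cons; apply: (SD _ _ _ IH).
suff -> (c : k) : mkmalgU m c = c *: (mkmalgU m 1 : malg_cm).
  exact: (SZ _ _ (Smon m)).
by apply/malgP => u; rewrite mcoeffU mcoeffZ mcoeffU mulrnAr mulr1.
Qed.

(* Ended by [Qed] so that conversion never unfolds the monoid algebra. *)
Definition free_comalg_exists : free_comalg k V.
Proof.
exact: (@FreeComalg k V malg_cm malg_var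
  (fun B f g => mmeval f g : {rmorphism malg_cm -> B}) mmeval_var mmeval_const
  malg_ind).
Qed.

End MonoidAlgebra.

Section PolynomialRing.
Variables (k : fieldType) (V : choiceType).

Definition cpoly : Type := fc_sort (free_comalg_exists k V).
HB.instance Definition _ :=
  GRing.ComAlgebra.copy cpoly (fc_sort (free_comalg_exists k V)).

Definition pvar (v : V) : cpoly := fc_var _ v.
Definition cpeval (B : comNzRingType) (f : {rmorphism k -> B}) (g : V -> B) :
  {rmorphism cpoly -> B} := fc_eval _ f g.

Lemma cpeval_var B f g v : @cpeval B f g (pvar v) = g v.
Proof. exact: fc_eval_var. Qed.

Lemma cpeval_const B f g c : @cpeval B f g c%:A = f c.
Proof. exact: fc_eval_const. Qed.

Definition cpoly_ind : forall S : cpoly -> Prop,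
  (forall v, S (pvar v)) -> (forall c, S c%:A) ->
  (forall p q, S p -> S q -> S (p + q)) ->
  (forall p q, S p -> S q -> S (p * q)) -> forall p, S p := @fc_ind _ _ _.

Lemma cpeval_ext (B : comNzRingType) (f g : {rmorphism cpoly -> B}) :
  (forall c, f c%:A = g c%:A) -> (forall v, f (pvar v) = g (pvar v)) -> f =1 g.
Proof.
move=> fg_c fg_v; elim/cpoly_ind => // p q Ep Eq.
  by rewrite !rmorphD Ep Eq.
by rewrite !rmorphM Ep Eq.
Qed.

Definition polyC_alg (B : comAlgType k) : k -> {poly B} := polyC \o in_alg B.
HB.instance Definition _ (B : comAlgType k) :=
  GRing.RMorphism.copy (@polyC_alg B) (polyC \o in_alg B).

(** The derivation with prescribed values [c] on the variables is the
    coefficient of ['X] in the Taylor-like substitution [v -> v + c v 'X]. *)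
Section Derivation.
Variable c : V -> cpoly.

Definition taylor : {rmorphism cpoly -> {poly cpoly}} :=
  cpeval (polyC_alg cpoly) (fun v => (pvar v)%:P + c v *: 'X).

Definition der (p : cpoly) : cpoly := (taylor p)`_1.

Lemma taylor0 p : (taylor p)`_0 = p.
Proof.
elim/cpoly_ind: p => [v|a|p q Ep Eq|p q Ep Eq].
- by rewrite /taylor cpeval_var coefD coefZ coefX coefC mulr0 addr0.
- by rewrite /taylor cpeval_const coefC.
- by rewrite rmorphD coefD Ep Eq.
- by rewrite rmorphM coefM big_ord1 Ep Eq.
Qed.

Lemma der_var v : der (pvar v) = c v.
Proof. by rewrite /der /taylor cpeval_var coefD coefZ coefX coefC mulr1 add0r.
  Qed.

Lemma der_const a : der a%:A = 0.
Proof. by rewrite /der /taylor cpeval_const coefC. Qed.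

Lemma derD p q : der (p + q) = der p + der q.
Proof. by rewrite /der rmorphD coefD. Qed.

Lemma derM p q : der (p * q) = p * der q + der p * q.
Proof.
by rewrite /der rmorphM coefM big_ord_recr big_ord1 /= !taylor0.
Qed.
End Derivation.


Definition derivation (D : cpoly -> cpoly) : Prop :=
  [/\ forall a, D a%:A = 0, {morph D : p q / p + q} &
      forall p q, D (p * q) = p * D q + D p * q].

Lemma der_derivation c : derivation (der c).
Proof. by split; [apply: der_const|apply: derD|apply: derM]. Qed.

Lemma derivation_ext D1 D2 : derivation D1 -> derivation D2 ->
  (forall v, D1 (pvar v) = D2 (pvar v)) -> D1 =1 D2.
Proof.
move=> [C1 A1 M1] [C2 A2 M2] E; elim/cpoly_ind => // [a|p q Ep Eq|p q Ep Eq].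
- by rewrite C1 C2.
- by rewrite A1 A2 Ep Eq.
- by rewrite M1 M2 Ep Eq.
Qed.

Section DerivationTheory.
Variable D : cpoly -> cpoly.
Hypothesis dD : derivation D.

Lemma derivation0 : D 0 = 0.
Proof. by case: dD => /(_ 0); rewrite scale0r. Qed.

Lemma derivationZ a p : D (a *: p) = a *: D p.
Proof.
by case: dD => C _ M; rewrite -mulr_algl M C mul0r addr0 mulr_algl.
Qed.

Lemma derivationN p : D (- p) = - D p.
Proof. by rewrite -scaleN1r derivationZ scaleN1r. Qed.

Lemma derivationB p q : D (p - q) = D p - D q.
Proof. by case: dD => _ A _; rewrite A derivationN. Qed.
End DerivationTheory.

Lemma derivation_zero : derivation (fun=> 0).
Proof. by split=> [a|p q|p q]; rewrite ?mulr0 ?mul0r ?addr0. Qed.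

Lemma derivation_add D1 D2 : derivation D1 -> derivation D2 ->
  derivation (fun p => D1 p + D2 p).
Proof.
move=> [C1 A1 M1] [C2 A2 M2]; split=> [a|p q|p q].
- by rewrite C1 C2 addr0.
- by rewrite A1 A2 addrACA.
- by rewrite M1 M2 mulrDr mulrDl addrACA.
Qed.

Lemma derivation_mul r D : derivation D -> derivation (fun p => r * D p).
Proof.
move=> [C A M]; split=> [a|p q|p q].
- by rewrite C mulr0.
- by rewrite A mulrDr.
- by rewrite M; ring.
Qed.

Lemma derivation_opp D : derivation D -> derivation (fun p => - D p).
Proof.
move=> /(derivation_mul (-1)) dD.
suff -> : (fun p => - D p) = fun p => -1 * D p by [].
by apply/funext => p; rewrite mulN1r.
Qed.

Lemma derivation_comm D1 D2 : derivation D1 -> derivation D2 ->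
  derivation (fun p => D1 (D2 p) - D2 (D1 p)).
Proof.
move=> d1 d2; have [C1 A1 M1] := d1; have [C2 A2 M2] := d2; split=> [a|p q|p q].
- by rewrite C1 C2 (derivation0 d1) (derivation0 d2) subr0.
- by rewrite A1 A2 A1 A2 opprD addrACA.
- by rewrite M1 M2 A1 A2 !M1 !M2; ring.
Qed.

Lemma derD_coef c1 c2 p : der (fun v => c1 v + c2 v) p = der c1 p + der c2 p.
Proof.
have d := derivation_add (der_derivation c1) (der_derivation c2).
apply: (derivation_ext (der_derivation _) d) => v.
by rewrite !der_var.
Qed.

Lemma derM_coef r c p : der (fun v => r * c v) p = r * der c p.
Proof.
have d := derivation_mul r (der_derivation c).
apply: (derivation_ext (der_derivation _) d) => v.
by rewrite !der_var.
Qed.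

(** A substitute for the support of [p], phrased through morphisms because [cpoly] is abstract. *)
Lemma cpoly_finite_vars (p : cpoly) : exists vs : seq V,
  forall (B : comNzRingType) (h1 h2 : {rmorphism cpoly -> B}),
    (forall c, h1 c%:A = h2 c%:A) ->
    (forall v, v \in vs -> h1 (pvar v) = h2 (pvar v)) -> h1 p = h2 p.
Proof.
elim/cpoly_ind: p => [v|c|p q [vs Ep] [us Eq]|p q [vs Ep] [us Eq]].
- by exists [:: v] => B h1 h2 _; apply; rewrite inE.
- by exists [::] => B h1 h2.
- exists (vs ++ us) => B h1 h2 hC hV.
  by rewrite !rmorphD (Ep _ h1 h2) ?(Eq _ h1 h2) // => v iv;
     apply: hV; rewrite mem_cat iv ?orbT.
- exists (vs ++ us) => B h1 h2 hC hV.
  by rewrite !rmorphM (Ep _ h1 h2) ?(Eq _ h1 h2) // => v iv;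
     apply: hV; rewrite mem_cat iv ?orbT.
Qed.

(** [B] is an iterated polynomial ring over [k], with one indeterminate adjoined for each entry of
    [vs], hence a domain; [to] sends all other variables to zero. *)
Lemma cpoly_finite_retract (vs : seq V) : exists (B : idomainType)
  (to : {rmorphism cpoly -> B}) (back : {rmorphism B -> cpoly}),
  (forall c, back (to c%:A) = c%:A) /\
  (forall v, v \in vs -> back (to (pvar v)) = pvar v).
Proof.
elim: vs => [|v vs [B [to [back [EC EV]]]]].
  exists k, (cpeval idfun (fun=> 0)), (in_alg cpoly).
  by split=> // c; rewrite /= cpeval_const.
pose f : {rmorphism k -> {poly B}} := polyC \o to \o in_alg cpoly.
pose to' := cpeval f (fun u => if u == v then 'X else (to (pvar u))%:P).
pose back' := horner_eval (pvar v) \o map_poly back.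
exists {poly B}, to', back'; split=> [c|u].
  by rewrite /back' /to' /= cpeval_const /= map_polyC /horner_eval hornerC;
    exact: EC.
rewrite inE /back' /to' /= cpeval_var /horner_eval;
  case: eqP => [-> _|_ /= uvs].
  by rewrite map_polyX hornerX.
by rewrite map_polyC hornerC; apply: EV.
Qed.

Lemma cpoly_mulf_eq0 (p q : cpoly) : p * q = 0 -> p = 0 \/ q = 0.
Proof.
have [vs Ep] := cpoly_finite_vars p; have [us Eq] := cpoly_finite_vars q.
have [B [to [back [EC EV]]]] := cpoly_finite_retract (vs ++ us).
move=> /(congr1 to)/eqP; rewrite rmorphM rmorph0 mulf_eq0.
have Kp : back (to p) = p.
  by apply: (Ep _ (back \o to) idfun) => // v iv; apply: EV; rewrite mem_cat iv.
have Kq : back (to q) = q.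
  by apply: (Eq _ (back \o to) idfun) => // v iv; apply: EV;
    rewrite mem_cat iv orbT.
by case/orP => /eqP E; [left; rewrite -Kp E|right; rewrite -Kq E];
  rewrite rmorph0.
Qed.

Definition pder (v : V) : cpoly -> cpoly := der (fun u => (u == v)%:R).

Lemma pder_derivation v : derivation (pder v).
Proof. exact: der_derivation. Qed.

Lemma pder_var v u : pder v (pvar u) = (u == v)%:R.
Proof. exact: der_var. Qed.

Definition kill (A : pred V) : {rmorphism cpoly -> cpoly} :=
  cpeval (in_alg cpoly) (fun v => if A v then 0 else pvar v).

Lemma kill_const A c : kill A c%:A = c%:A.
Proof. exact: cpeval_const. Qed.

Lemma kill_var A v : kill A (pvar v) = if A v then 0 else pvar v.
Proof. exact: cpeval_var. Qed.

Hypothesis k0 : [pchar k] =i pred0.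

Lemma char0_natr n : (n.+1%:R : k) != 0.
Proof. by move/pcharf0P: k0 => ->. Qed.

Lemma cpoly_mulrn_eq0 (p : cpoly) n : p *+ n.+1 = 0 -> p = 0.
Proof.
move=> E; have : (n.+1%:R : k)^-1 *: (p *+ n.+1) = 0 by rewrite E scaler0.
by rewrite -scaler_nat scalerA mulVf ?char0_natr // scale1r.
Qed.

(** Substituting [v 'X] for [v] turns [p] into a polynomial in ['X] whose derivative is a multiple
    of the image of [pder v p]. In characteristic zero it is therefore constant, and its values at 0
    and 1 are the two sides. *)
Lemma kill1 (p : cpoly) v : pder v p = 0 -> kill (pred1 v) p = p.
Proof.
pose f := cpeval (polyC_alg cpoly)
  (fun u => if u == v then pvar v *: 'X else (pvar u)%:P).
have df q : (f q)^`() = pvar v *: f (pder v q).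
  elim/cpoly_ind: q => [u|c|q r Eq Er|q r Eq Er].
  - rewrite pder_var cpeval_var; case: eqP => _.
      by rewrite rmorph1 derivZ derivX.
    by rewrite rmorph0 scaler0 derivC.
  - by rewrite /f cpeval_const derivC /pder der_const rmorph0 scaler0.
  - by rewrite rmorphD derivD Eq Er /pder derD rmorphD scalerDr.
  - rewrite rmorphM derivM Eq Er /pder derM rmorphD !rmorphM scalerDr.
    by rewrite -scalerAl -scalerAr addrC.
move=> dp; have fC : f p = ((f p)`_0)%:P.
  apply/polyP => -[|i]; rewrite coefC //=.
  have /(congr1 (fun q : {poly cpoly} => q`_i)) := df p.
  by rewrite dp rmorph0 scaler0 coef0 coef_deriv => /cpoly_mulrn_eq0.
have f0 : (f p).[0] = kill (pred1 v) p.
  apply: (cpeval_ext (f := horner_eval 0 \o f)) => [c|u] /=.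
    by rewrite /f cpeval_const /= /horner_eval hornerC kill_const.
  rewrite /f cpeval_var kill_var /= /horner_eval.
  by case: eqP; rewrite ?hornerZ ?hornerX ?mulr0 ?hornerC.
have f1 : (f p).[1] = p.
  apply: (cpeval_ext (f := horner_eval 1 \o f) (g := idfun)) => [c|u] /=.
    by rewrite /f cpeval_const /= /horner_eval hornerC.
  rewrite /f cpeval_var /= /horner_eval.
  by case: eqP => [->|_]; rewrite ?hornerZ ?hornerX ?mulr1 ?hornerC.
by rewrite -f0 -[RHS]f1 fC !hornerC.
Qed.

Lemma kill_id (A : pred V) (p : cpoly) :
  (forall v, A v -> pder v p = 0) -> kill A p = p.
Proof.
move=> dp; have [vs Ep] := cpoly_finite_vars p.
(* [A] may be infinite; its trace on the variables of [p] is finite, so the variables can be killed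
   one at a time. *)
have -> : kill A p = kill [pred v | (v \in vs) && A v] p.
  by apply: Ep => [c|v iv]; rewrite ?kill_const // !kill_var /= iv.
elim: vs {Ep} => [|v vs IH].
  by apply: (cpeval_ext (g := idfun)) => [c|v]; rewrite ?kill_const ?kill_var.
rewrite -[RHS]IH; case Av: (A v); last first.
  apply: cpeval_ext => [c|u]; rewrite ?kill_const // !kill_var /= inE.
  by case: eqP => // ->; rewrite Av !andbF.
rewrite -[in RHS](kill1 (dp _ Av)).
apply: (cpeval_ext (g := kill _ \o kill _)) => [c|u] /=.
  by rewrite !kill_const.
rewrite !kill_var /= inE; case: eqP => [->|_] /=.
  by rewrite Av rmorph0.
by rewrite kill_var.
Qed.

End PolynomialRing.

(** * The Lie-Poisson algebra of words *)

(** The symmetric algebra of the free associative algebra on the letters [L],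
    with a variable for each word and the Lie-Poisson bracket
    [{u, v} = uv - vu]. *)
Section WordPoisson.
Variables (k : fieldType) (L : choiceType).

Local Notation wpoly := (cpoly k (seq L)).

Definition tvar (w : seq L) : wpoly := pvar k w.

Definition ham (u : seq L) : wpoly -> wpoly :=
  der (fun v => tvar (u ++ v) - tvar (v ++ u)).

Lemma ham_derivation u : derivation (ham u).
Proof. exact: der_derivation. Qed.

Lemma ham_var u v : ham u (tvar v) = tvar (u ++ v) - tvar (v ++ u).
Proof. exact: der_var. Qed.

(** The derivation [{p, _}] is prescribed on words by [{p, v} = - {v, p}], with [ham v] in the role
    of [{v, _}]. *)
Definition wbr (p q : wpoly) : wpoly := der (fun v => - ham v p) q.

Lemma wbr_derivationr p : derivation (wbr p).
Proof. exact: der_derivation. Qed.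

Lemma wbr_derivationl q : derivation (wbr^~ q).
Proof.
have dN v := derivation_opp (ham_derivation v).
split=> [a|p r|p r]; rewrite /wbr.
- rewrite (_ : (fun v => _) = fun v => 0 * 0); last first.
    by apply/funext => v; case: (dN v) => /(_ a) -> _ _; rewrite mul0r.
  by rewrite derM_coef mul0r.
- rewrite -derD_coef; congr (der _ q); apply/funext => v.
  by case: (dN v).
- have -> : (fun v => - ham v (p * r)) =
      (fun v => p * - ham v r + r * - ham v p).
    by apply/funext => v; case: (dN v) => _ _ ->; rewrite [_ * r]mulrC.
  by rewrite derD_coef !derM_coef [r * _]mulrC.
Qed.

Lemma wbr_varl u q : wbr (tvar u) q = ham u q.
Proof.
apply: derivation_ext q => [||v]; first exact: wbr_derivationr.
  exact: ham_derivation.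
by rewrite /wbr der_var !ham_var opprB.
Qed.

Lemma wbrC p q : wbr p q = - wbr q p.
Proof.
move: p; apply: derivation_ext => [||u]; first exact: wbr_derivationl.
  exact: derivation_opp (wbr_derivationr q).
move: q; apply: derivation_ext => [||v]; first exact: wbr_derivationr.
  exact: derivation_opp (wbr_derivationl _).
by rewrite !wbr_varl !ham_var opprB.
Qed.

Fact wbr_linearl q : linear (wbr^~ q).
Proof.
have d := wbr_derivationl q; move=> a p r /=.
by case: (d) => _ -> _; rewrite (derivationZ d).
Qed.

Fact wbr_linearr q : linear (wbr q).
Proof.
have d := wbr_derivationr q; move=> a p r /=.
by case: (d) => _ -> _; rewrite (derivationZ d).
Qed.

Fact wbr_leibniz p q r : wbr p (q * r) = wbr p q * r + q * wbr p r.
Proof. by case: (wbr_derivationr p) => _ _ ->; rewrite addrC. Qed.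

Fact wbrxx p : wbr p p = 0.
Proof.
elim/cpoly_ind: p => [v|a|p q Ep Eq|p q Ep Eq].
- by rewrite wbr_varl ham_var subrr.
- by case: (wbr_derivationr (a%:A)) => ->.
- case: (wbr_derivationr (p + q)) => _ -> _.
  case: (wbr_derivationl p) => _ -> _; case: (wbr_derivationl q) => _ -> _.
  by rewrite Ep Eq add0r addr0 wbrC addNr.
- case: (wbr_derivationr (p * q)) => _ _ ->.
  case: (wbr_derivationl p) => _ _ ->; case: (wbr_derivationl q) => _ _ ->.
  by rewrite Ep Eq [wbr q p]wbrC; ring.
Qed.

Let jac p q r := wbr p (wbr q r) + wbr q (wbr r p) + wbr r (wbr p q).

Let jac_rot p q r : jac p q r = jac q r p.
Proof. by rewrite /jac -addrA addrC. Qed.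

Let jac_derivation q r : derivation (fun p => jac p q r).
Proof.
have [Cq Aq Mq] := wbr_derivationr q; have [Cr Ar Mr] := wbr_derivationr r.
have [Cl Al Ml] := wbr_derivationl q; have [_ Al' Ml'] := wbr_derivationl r.
have [Cqr Aqr Mqr] := wbr_derivationl (wbr q r).
split=> [a|p s|p s]; rewrite /jac.
- rewrite Cqr Cr Cl (derivation0 (wbr_derivationr r)).
  by rewrite (derivation0 (wbr_derivationr q)) !addr0.
- by rewrite Aqr Al Ar Ar Aq; ring.
- rewrite Mqr Mr Ml Aq Ar !Mq !Mr [wbr s q]wbrC [wbr p q]wbrC.
  rewrite !(derivationN (wbr_derivationr r)); ring.
Qed.

(** The Jacobiator is cyclic and a derivation in its first argument, hence in each. It thus vanishes
    if it does so on words, where associativity of concatenation cancels all terms. *)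
Fact wbr_jacobi p q r :
  wbr p (wbr q r) + wbr q (wbr r p) + wbr r (wbr p q) = 0.
Proof.
rewrite -/(jac p q r); have d0 := @derivation_zero k (seq L).
move: p; apply: (derivation_ext _ d0) => // u.
rewrite jac_rot; move: q; apply: (derivation_ext _ d0) => // v.
rewrite jac_rot; move: r; apply: (derivation_ext _ d0) => // w.
rewrite /jac !wbr_varl !ham_var !(derivationB (ham_derivation _)) !ham_var.
rewrite !catA; ring.
Qed.

HB.instance Definition _ :=
  isPoisson.Build k wpoly wbr_linearl wbr_linearr wbrxx wbr_jacobi wbr_leibniz.

End WordPoisson.

(** * Lie monomials and the embedding of the free Poisson algebra *)

Section LieMonomials.
Variables (k : fieldType) (I : eqType).

Inductive lietree : Type := Leaf of I | Node of lietree & lietree.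

Fixpoint lsize (t : lietree) : nat :=
  if t is Node l r then (lsize l + lsize r)%N else 1.

Lemma lsize_gt0 t : (0 < lsize t)%N.
Proof. by elim: t => //= l IH r _; rewrite addn_gt0 IH. Qed.

Fixpoint tree_eval (Q : poissonAlgType k) (f : I -> Q) (t : lietree) : Q :=
  match t with
  | Leaf i => f i
  | Node l r => pbr (tree_eval f l) (tree_eval f r)
  end.

(** Unreduced linear combinations of words represent elements of the free associative algebra;
    [wlin] is the linear extension of a function of words, and [tree_comb] expands a Lie
    monomial. *)
Definition wcomb : Type := seq (k * seq I).

Definition wlin (V : lmodType k) (b : wcomb) (g : seq I -> V) : V :=
  \sum_(c <- b) c.1 *: g c.2.

Definition wmul (a : k) (b c : wcomb) : wcomb :=
  [seq (a * (x.1 * y.1), x.2 ++ y.2) | x <- b, y <- c].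

Fixpoint tree_comb (t : lietree) : wcomb :=
  match t with
  | Leaf i => [:: (1, [:: i])]
  | Node l r => wmul 1 (tree_comb l) (tree_comb r) ++
                wmul (-1) (tree_comb r) (tree_comb l)
  end.

Lemma wlin_leaf (V : lmodType k) (g : seq I -> V) i :
  wlin (tree_comb (Leaf i)) g = g [:: i].
Proof. by rewrite /wlin big_seq1 scale1r. Qed.

Lemma wlin_mul (V : lmodType k) a b c (g : seq I -> V) :
  wlin (wmul a b c) g = a *: wlin b (fun u => wlin c (fun v => g (u ++ v))).
Proof.
rewrite /wlin big_allpairs_dep /= scaler_sumr; apply: eq_bigr => x _.
rewrite scalerA scaler_sumr; apply: eq_bigr => y _.
by rewrite scalerA mulrA.
Qed.

Lemma wlin_node (V : lmodType k) l r (g : seq I -> V) :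
  wlin (tree_comb (Node l r)) g =
  wlin (tree_comb l) (fun u => wlin (tree_comb r) (fun v => g (u ++ v))) -
  wlin (tree_comb r) (fun u => wlin (tree_comb l) (fun v => g (u ++ v))).
Proof.
rewrite /= [LHS]/wlin big_cat /= -!/(wlin _ _) !wlin_mul.
by rewrite scale1r scaleN1r.
Qed.

Lemma wlinB (V : lmodType k) b (g1 g2 : seq I -> V) :
  wlin b (fun u => g1 u - g2 u) = wlin b g1 - wlin b g2.
Proof. by rewrite /wlin -sumrB; apply: eq_bigr => c _; rewrite scalerBr. Qed.

Lemma wlin_linear (V W : lmodType k) (F : V -> W) b (g : seq I -> V) :
  linear F -> F (wlin b g) = wlin b (F \o g).
Proof.
move=> Fl; have F0 : F 0 = 0.
  by have := Fl (-1) 0 0; rewrite scaler0 addr0 scaleN1r addNr.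
rewrite /wlin; elim: b => [|c b IH]; first by rewrite !big_nil.
by rewrite !big_cons Fl IH.
Qed.

Lemma wlinC (V : lmodType k) b c (g : seq I -> seq I -> V) :
  wlin b (fun u => wlin c (g u)) = wlin c (fun v => wlin b (g^~ v)).
Proof.
rewrite /wlin; under eq_bigr do rewrite scaler_sumr.
rewrite exchange_big /=; apply: eq_bigr => x _; rewrite scaler_sumr.
by apply: eq_bigr => y _; rewrite !scalerA mulrC.
Qed.

Lemma tree_comb_size t : all (fun c => size c.2 == lsize t) (tree_comb t).
Proof.
elim: t => //= l IHl r IHr; rewrite all_cat; apply/andP; split.
  apply/allP => c /allpairsP[[x y] /= [xl yr ->]] /=.
  by rewrite size_cat (eqP (allP IHl _ xl)) (eqP (allP IHr _ yr)).
apply/allP => c /allpairsP[[x y] /= [xl yr ->]] /=.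
by rewrite size_cat (eqP (allP IHr _ xl)) (eqP (allP IHl _ yr)) addnC.
Qed.

Lemma eq_wlin_tree (V : lmodType k) t (g1 g2 : seq I -> V) :
  (forall w, size w = lsize t -> g1 w = g2 w) ->
  wlin (tree_comb t) g1 = wlin (tree_comb t) g2.
Proof.
move=> E; rewrite /wlin !big_seq; apply: eq_bigr => c ct.
by rewrite E // (eqP (allP (tree_comb_size t) _ ct)).
Qed.

End LieMonomials.
Arguments wlin_node {k I V l r} g.

Section FreePoissonLie.
Variables (k : fieldType) (n : nat).
Local Notation P := (freePoisson k n).
Local Notation S := (cpoly k (seq (option 'I_n))).
Local Notation tree := (lietree 'I_n).

Lemma pbr_const (Q : poissonAlgType k) (p : Q) c : pbr p c%:A = 0.
Proof.
have p1 : pbr p 1 = 0.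
  by have /eqP := pbr_leibniz p 1 1;
    rewrite !mulr1 mul1r addrC -subr_eq subrr => /eqP.
have := pbr_linearr p c 1 0; rewrite addr0 p1 scaler0 add0r => ->.
by have := pbr_linearr p (-1) 0 0; rewrite scaler0 addr0 scaleN1r addNr.
Qed.

(** Brackets are confined to Lie monomials, so that inductions over [P] need no case for the bracket
    of arbitrary elements. *)
Inductive lie_generated : P -> Prop :=
| LieTree t : lie_generated (tree_eval (fpvar k) t)
| LieConst c : lie_generated c%:A
| LieAdd p q of lie_generated p & lie_generated q : lie_generated (p + q)
| LieMul p q of lie_generated p & lie_generated q : lie_generated (p * q).

(** Constants are central, and the Leibniz rule in both arguments pushes a bracket down to two Lie
    monomials, which it joins into one. *)
Lemma freePoisson_lie_generated p : lie_generated p.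
Proof.
elim/freePoisson_ind: p => [i|c|p q|p q|p q Gp Gq].
- exact: (LieTree (Leaf i)).
- exact: LieConst.
- exact: LieAdd.
- exact: LieMul.
elim: Gp => {p} [t|c|p p' _ G _ G'|p p' Gp G Gp' G'].
- elim: Gq => {q} [t'|c|q q' _ G _ G'|q q' Gq G Gq' G'].
  + exact: (LieTree (Node t t')).
  + by rewrite pbr_const -(scale0r 1); apply: LieConst.
  + by rewrite pbrDr; apply: LieAdd.
  + by rewrite pbr_leibniz; apply: LieAdd; apply: LieMul.
- rewrite pbrC pbr_const oppr0 -(scale0r 1); exact: LieConst.
- by rewrite pbrDl; apply: LieAdd.
- rewrite pbrC pbr_leibniz opprD -mulNr -mulrN -!pbrC.
  by apply: LieAdd; apply: LieMul.
Qed.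

Definition wlift (w : seq 'I_n) : seq (option 'I_n) := map Some w.

Definition phi : P -> S := fpeval (fun i => tvar k [:: Some i]).
HB.instance Definition _ := GRing.RMorphism.on phi.

Lemma phi_linear : linear phi.
Proof. exact: fpeval_linear. Qed.

Lemma phi_pbr p q : phi (pbr p q) = pbr (phi p) (phi q).
Proof. exact: fpeval_poisson. Qed.

Lemma phi_const c : phi c%:A = c%:A.
Proof.
have := phi_linear c 1 0; rewrite addr0 rmorph1 => ->.
by rewrite rmorph0 addr0.
Qed.

Lemma phi_tree t : phi (tree_eval (fpvar k) t) =
  wlin (tree_comb k t) (fun w => tvar k (wlift w)).
Proof.
elim: t => [i|l IHl r IHr]; first by rewrite wlin_leaf /phi fpeval_var.
rewrite phi_pbr IHl IHr wlin_node.
rewrite (wlin_linear (F := fun p => pbr p _)); last exact: pbr_linearl.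
rewrite [X in _ = _ - X]wlinC -wlinB; congr wlin; apply/funext => u /=.
rewrite (wlin_linear (F := pbr _)); last exact: pbr_linearr.
rewrite -wlinB; congr wlin; apply/funext => v /=.
by rewrite [pbr _ _]wbr_varl ham_var /wlift !map_cat.
Qed.

(** * Right-normed bracketing and the retraction *)

Section Dynkin.

Definition adw (w : seq 'I_n) (q : P) : P :=
  foldr (fun i => pbr (fpvar k i)) q w.

Fixpoint dynkin (w : seq 'I_n) : P :=
  match w with
  | [::] => 0
  | [:: i] => fpvar k i
  | i :: w' => pbr (fpvar k i) (dynkin w')
  end.

Lemma adw_linear w : linear (adw w).
Proof.
by elim: w => [|i w IH] a p q //=; rewrite IH pbr_linearr.
Qed.

Lemma dynkin_cat u v : v != [::] -> dynkin (u ++ v) = adw u (dynkin v).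
Proof.
case: v => // j v _; elim: u => //= i u <-.
by case: u.
Qed.

(** [adw] extends the adjoint action to the free associative algebra; by the Jacobi identity a
    commutator there acts as the bracket. *)
Lemma wlin_adw t q :
  wlin (tree_comb k t) (fun w => adw w q) = pbr (tree_eval (fpvar k) t) q.
Proof.
elim: t q => [i|l IHl r IHr] q; first by rewrite wlin_leaf.
have E (s t : tree) : (forall q, wlin (tree_comb k s) (fun w => adw w q) =
      pbr (tree_eval (fpvar k) s) q) ->
    (forall q, wlin (tree_comb k t) (fun w => adw w q) =
      pbr (tree_eval (fpvar k) t) q) ->
    wlin (tree_comb k s) (fun u => wlin (tree_comb k t) (fun v => adw (u ++ v)
      q))
    = pbr (tree_eval (fpvar k) s) (pbr (tree_eval (fpvar k) t) q).
  move=> Es Et; rewrite -Es; congr wlin; apply/funext => u.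
  rewrite -Et (wlin_linear _ _ (adw_linear u)); congr wlin;
    apply/funext => v /=.
  by rewrite /adw foldr_cat.
rewrite wlin_node (E l r) // (E r l) //=; set a := tree_eval _ l;
  set b := tree_eval _ r.
have := pbr_jacobi a b q; rewrite [pbr q a]pbrC pbrNr [pbr q _]pbrC.
by move/eqP; rewrite subr_eq0 => /eqP.
Qed.

(** The Dynkin-Specht-Wever identity. Bracketing a product [l r] gives [ad l] applied to the
    bracketing of [r], that is [|r| {l, r}] by induction; subtracting the term with [l] and [r]
    exchanged gives [(|l| + |r|) {l, r}]. *)
Lemma wlin_dynkin t : wlin (tree_comb k t) dynkin =
  (lsize t)%:R *: tree_eval (fpvar k) t.
Proof.
have E (s t' : tree) : wlin (tree_comb k t') dynkin =
      (lsize t')%:R *: tree_eval (fpvar k) t' ->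
    wlin (tree_comb k s) (fun u => wlin (tree_comb k t') (fun v => dynkin (u
      ++ v)))
    = (lsize t')%:R *: pbr (tree_eval (fpvar k) s) (tree_eval (fpvar k) t').
  move=> Et;
    have -> : (fun u => wlin (tree_comb k t') (fun v => dynkin (u ++ v)))
    = (fun u => adw u ((lsize t')%:R *: tree_eval (fpvar k) t')).
    apply/funext => u; rewrite -Et (wlin_linear _ _ (adw_linear u)).
    apply: eq_wlin_tree => w sw /=; rewrite dynkin_cat // -size_eq0 sw.
    by rewrite -lt0n lsize_gt0.
  rewrite wlin_adw; have := pbr_linearr (tree_eval (fpvar k) s) (lsize t')%:R
    (tree_eval (fpvar k) t') 0; rewrite addr0 => ->.
  have := pbr_const (tree_eval (fpvar k) s) 0; rewrite scale0r => ->.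
  by rewrite addr0.
elim: t => [i|l IHl r IHr]; first by rewrite wlin_leaf scale1r.
rewrite wlin_node (E l r) // (E r l) //= [pbr _ (tree_eval _ l)]pbrC.
by rewrite scalerN opprK -scalerDl natrD addrC.
Qed.

Hypothesis k0 : [pchar k] =i pred0.

Definition retract : {rmorphism S -> P} :=
  cpeval (in_alg P) (fun w => (size w)%:R^-1 *: dynkin (pmap id w)).

Lemma retract_var w :
  retract (tvar k w) = (size w)%:R^-1 *: dynkin (pmap id w).
Proof. exact: cpeval_var. Qed.

Lemma retract_linear : linear retract.
Proof.
by move=> a p q;
  rewrite rmorphD -mulr_algl rmorphM [retract a%:A]cpeval_const mulr_algl.
Qed.

(** On a Lie monomial this is [wlin_dynkin] divided by the degree, which is invertible in
    characteristic zero; both maps being ring morphisms, the rest follows. *)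
Lemma phiK : cancel phi retract.
Proof.
move=> p; elim: (freePoisson_lie_generated p) => {p} [t|c|p q _ Ep _ Eq|p q _
  Ep _ Eq].
- rewrite phi_tree (wlin_linear _ _ retract_linear).
  have [m mE] : exists m, lsize t = m.+1.
    by case: (lsize t) (lsize_gt0 t) => // m _; exists m.
  rewrite (@eq_wlin_tree _ _ _ _ _ (fun w => (lsize t)%:R^-1 *: dynkin w)).
    rewrite -(@wlin_linear _ _ _ _ (fun p : P => (lsize t)%:R^-1 *: p)).
      by rewrite wlin_dynkin scalerA mulVf ?scale1r // mE char0_natr.
    by move=> a p q; rewrite scalerDr !scalerA mulrC.
  move=> w sw; rewrite /= retract_var size_map sw; congr (_ *: dynkin _).
  by rewrite /wlift map_pK.
- by rewrite phi_const; apply: cpeval_const.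
- by rewrite !rmorphD Ep Eq.
- by rewrite !rmorphM Ep Eq.
Qed.

(** By [kill_id], all variables of [phi p] except the one-letter words [Some i] may be set to zero;
    [retract] sends those letters to the generators. *)
Lemma in_polynomials_retract (p : P) :
  (forall v : seq (option 'I_n), size v != 1%N -> pder v (phi p) = 0) ->
  (forall v : seq (option 'I_n), None \in v -> pder v (phi p) = 0) ->
  in_polynomials p.
Proof.
move=> d1 dN T [T1 TZ TM] TV; rewrite -(phiK p).
pose A : pred (seq (option 'I_n)) := fun v => (size v != 1%N) || (None \in v).
rewrite -(@kill_id _ _ k0 A (phi p)); last by move=> v /orP[];
  [exact: d1|exact: dN].
have T0 : 0 \in T by have := TZ (-1) _ _ T1 T1; rewrite scaleN1r addNr.
have TC c : c%:A \in T by have := TZ c _ _ T1 T0; rewrite addr0.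
have TD : {in T &, forall p q, p + q \in T}.
  by move=> u v uT vT; have := TZ 1 _ _ uT vT; rewrite scale1r.
elim/cpoly_ind: (phi p) => [v|c|q r Tq Tr|q r Tq Tr].
- rewrite kill_var /A; case: ifP; first by rewrite rmorph0.
  case: v => [|[i|] [|? ?]] //= _; rewrite retract_var /= invr1 scale1r.
  exact: TV.
- by rewrite kill_const [retract _]cpeval_const; apply: TC.
- by rewrite !rmorphD TD.
- by rewrite !rmorphM TM.
Qed.

End Dynkin.

End FreePoissonLie.

(** * Shuffles and primitive elements *)

Section Shuffle.
Variables (R : comNzRingType) (I : eqType).
Implicit Types (u v w : seq I) (e g : seq I -> R).

(** [sh u v e] is the sum of [e] over all shuffles of [u] and [v]; that is, the
    coefficient of [u (x) v] in the coproduct of [e] for which letters are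
    primitive. *)
Fixpoint sh u : seq I -> (seq I -> R) -> R :=
  match u with
  | [::] => fun v e => e v
  | i :: u' => fix shi v e :=
      match v with
      | [::] => e (i :: u')
      | j :: v' => sh u' (j :: v') (fun w => e (i :: w)) +
                   shi v' (fun w => e (j :: w))
      end
  end.

Lemma sh0r u e : sh u [::] e = e u.
Proof. by case: u. Qed.

Lemma sh_cons i u j v e : sh (i :: u) (j :: v) e =
  sh u (j :: v) (fun w => e (i :: w)) + sh (i :: u) v (fun w => e (j :: w)).
Proof. by []. Qed.

Lemma sh_ind (T : seq I -> seq I -> (seq I -> R) -> Prop) :
  (forall v e, T [::] v e) -> (forall u e, T u [::] e) ->
  (forall i u j v e, T u (j :: v) (fun w => e (i :: w)) ->
    T (i :: u) v (fun w => e (j :: w)) -> T (i :: u) (j :: v) e) ->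
  forall u v e, T u v e.
Proof.
move=> T0 T1 TS; elim=> [|i u IHu] //; elim=> [|j v IHv] // e.
exact: TS.
Qed.

Lemma eq_sh u v e1 e2 :
  (forall w, size w = (size u + size v)%N -> e1 w = e2 w) ->
  sh u v e1 = sh u v e2.
Proof.
move: u v e1 e2; apply: (sh_ind (T := fun u v e1 => forall e2, _ -> _ = _)).
- by move=> v e1 e2; apply.
- by move=> u e1 e2 E; rewrite !sh0r E // addn0.
- move=> i u j v e1 IH1 IH2 e2 E; rewrite !sh_cons.
  congr (_ + _); [apply: IH1|apply: IH2] => w sw; apply: E => /=;
    rewrite sw //=.
  by rewrite addnS.
Qed.

Lemma sh0 u v : sh u v (fun=> 0) = 0.
Proof.
elim: u v => [|i u IHu] //; elim=> [|j v IHv] //.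
by rewrite sh_cons IHu IHv addr0.
Qed.

Lemma sh_eq0 u v e : (forall w, size w = (size u + size v)%N -> e w = 0) ->
  sh u v e = 0.
Proof. by move=> E; rewrite -(sh0 u v); apply: eq_sh. Qed.

Lemma shD u v e1 e2 : sh u v (fun w => e1 w + e2 w) = sh u v e1 + sh u v e2.
Proof.
move: u v e1 e2; apply: (sh_ind (T := fun u v e1 => forall e2, _ = _)).
- by [].
- by move=> u e1 e2; rewrite !sh0r.
- by move=> i u j v e1 IH1 IH2 e2; rewrite !sh_cons IH1 IH2 addrACA.
Qed.

Lemma shM r u v e : sh u v (fun w => r * e w) = r * sh u v e.
Proof.
move: u v e; apply: sh_ind => [||i u j v e IH1 IH2] //.
  by move=> u e; rewrite !sh0r.
by rewrite !sh_cons IH1 IH2 mulrDr.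
Qed.

Lemma shB u v e1 e2 : sh u v (fun w => e1 w - e2 w) = sh u v e1 - sh u v e2.
Proof.
rewrite -mulN1r -shM -shD; apply: eq_sh => w _; by rewrite mulN1r.
Qed.

(** The coproduct of [g] has no mixed terms: Ree's shuffle criterion for Lie elements. *)
Definition primitive g := forall u v, u != [::] -> v != [::] -> sh u v g = 0.

(** [Delta (e g) = Delta e (g (x) 1 + 1 (x) g)] for [g] primitive, homogeneous
    of degree [M]. *)
Lemma sh_prod M g : (0 < M)%N -> primitive g -> forall p e u v,
  (size u + size v = p + M)%N ->
  sh u v (fun w => e (take p w) * g (drop p w)) =
  (if (M <= size u)%N then
     sh (take (size u - M) u) v e * g (drop (size u - M) u) else 0) +
  (if (M <= size v)%N then
     sh u (take (size v - M) v) e * g (drop (size v - M) v) else 0).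
Proof.
move=> M0 gP; elim=> [|p IH] e u v.
  rewrite add0n => suv.
  under eq_sh => w _ do rewrite take0 drop0; rewrite shM.
  case: u v suv => [|i u] [|j v] /= suv; try by lia.
  - rewrite add0n in suv; rewrite suv leqnn subnn take0 drop0 /=.
    by rewrite leqNgt M0 add0r.
  - rewrite addn0 in suv; rewrite suv leqnn subnn take0 drop0 /=.
    by rewrite leqNgt M0 addr0.
  - have /= -> := gP (i :: u) (j :: v) isT isT.
    by rewrite mulr0 !ifF ?addr0 //; lia.
case: u v => [|i u] [|j v] suv; rewrite /= in suv; try by lia.
- rewrite /= leqNgt M0 /= add0r ifT; last by lia.
  by have -> : ((size v).+1 - M)%N = p.+1 by lia.
- rewrite /= addn0 in suv; rewrite sh0r /= ifT; last by lia.
  rewrite leqNgt M0 /= addr0 sh0r.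
  by have -> : ((size u).+1 - M)%N = p.+1 by lia.
rewrite sh_cons (IH (fun w => e (i :: w))); last by rewrite /=; lia.
rewrite (IH (fun w => e (j :: w))); last by rewrite /=; lia.
rewrite addrACA; congr (_ + _).
- case: (ltngtP M (size (i :: u))) => /= [Mu|Mu|->].
  + by have Mu' : (M <= size u)%N := Mu; rewrite Mu' subSn //= mulrDl.
  + by rewrite leqNgt (ltn_trans _ Mu) // addr0.
  + by rewrite ltnn subnn /= add0r.
- case: (ltngtP M (size (j :: v))) => /= [Mu|Mu|->].
  + by have Mu' : (M <= size v)%N := Mu; rewrite Mu' subSn //= mulrDl.
  + by rewrite leqNgt (ltn_trans _ Mu) // addr0.
  + by rewrite ltnn subnn /= addr0 !sh0r.
Qed.

Definition homog M g := forall w, size w != M -> g w = 0.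

(** The product, for concatenation, of [e] with the part of degree [M] of [g]. *)
Definition wprod M e g w : R :=
  if (M <= size w)%N
  then e (take (size w - M) w) * g (drop (size w - M) w) else 0.

Lemma sh_wprod M e g u v : (0 < M)%N -> primitive g -> (M <= size u + size
  v)%N ->
  sh u v (wprod M e g) =
  (if (M <= size u)%N then
     sh (take (size u - M) u) v e * g (drop (size u - M) u) else 0) +
  (if (M <= size v)%N then
     sh u (take (size v - M) v) e * g (drop (size v - M) v) else 0).
Proof.
move=> M0 gP uvM; rewrite -(sh_prod M0 gP (p := size u + size v - M)).
  by apply: eq_sh => w sw; rewrite /wprod sw uvM.
by rewrite subnK.
Qed.

(** In the coproduct of [e g - g e] the mixed terms [e (x) g] and [g (x) e] each occur with both
    signs and cancel. *)
Lemma primitive_comm p e M g : (0 < p)%N -> (0 < M)%N -> homog p e ->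
  homog M g -> primitive e -> primitive g ->
  primitive (fun w => wprod M e g w - wprod p g e w).
Proof.
move=> p0 M0 eh gh eP gP u v u0 v0.
have [suv|/eqP suv] := eqVneq (size u + size v)%N (p + M)%N; last first.
  apply: sh_eq0 => w sw; rewrite /wprod.
  rewrite [X in X - _](_ : _ = 0); last first.
    case: ifP => // Mw; rewrite eh ?mul0r // size_takel ?leq_subr //.
    by apply/eqP => E; case: suv; rewrite -sw; lia.
  rewrite sub0r; apply/eqP; rewrite oppr_eq0; apply/eqP.
  case: ifP => // Mw; rewrite gh ?mul0r // size_takel ?leq_subr //.
  by apply/eqP => E; case: suv; rewrite -sw; lia.
rewrite shB !sh_wprod //; try by lia.
(* A term of [sh_wprod] survives only when the removed suffix is all of [x]; otherwise a proper
   shuffle of the primitive [h] remains. *)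
have El a b h (hP : primitive h) (c : R) (x : seq I) : b != [::] ->
    (if (a <= size x)%N then sh (take (size x - a) x) b h * c else 0) =
    if size x == a then h b * c else 0.
  move=> b0; case: (ltngtP a (size x)) => // [lt|->].
    rewrite hP ?mul0r // -size_eq0 size_takel ?leq_subr //.
    by rewrite subn_eq0 -ltnNge.
  by rewrite subnn take0.
have Er a b h (hP : primitive h) (c : R) (x : seq I) : b != [::] ->
    (if (a <= size x)%N then sh b (take (size x - a) x) h * c else 0) =
    if size x == a then h b * c else 0.
  move=> b0; case: (ltngtP a (size x)) => // [lt|->].
    rewrite hP ?mul0r // -size_eq0 size_takel ?leq_subr //.
    by rewrite subn_eq0 -ltnNge.
  by rewrite subnn take0 sh0r.
rewrite !El // !Er //.
have -> : (size u == M) = (size v == p) by apply/eqP/eqP; lia.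
have -> : (size v == M) = (size u == p) by apply/eqP/eqP; lia.
have [/eqP vp|_] := ifP; have [/eqP up|_] := ifP.
- have -> : (size u - M)%N = 0%N by lia.
  have -> : (size v - M)%N = 0%N by lia.
  by rewrite up vp subnn !drop0; ring.
- have -> : (size u - M)%N = 0%N by lia.
  by rewrite vp subnn !drop0; ring.
- have -> : (size v - M)%N = 0%N by lia.
  by rewrite up subnn !drop0; ring.
- by rewrite addr0 subrr.
Qed.

(** * Left multiples of primitive elements *)

Section NoLeftMultiple.
Hypothesis Rdom : forall a b : R, a * b = 0 -> a = 0 \/ b = 0.
Hypothesis R0 : forall (a : R) m, a *+ m.+1 = 0 -> a = 0.

Let cut N e w : R := if size w == N then e w else 0.

Let cut_primitive N e : primitive e -> primitive (cut N e).
Proof.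
move=> eP u v u0 v0; have [E|/negbTE E] := eqVneq (size u + size v)%N N.
  rewrite -[RHS](eP _ _ u0 v0); apply: eq_sh => w sw.
  by rewrite /cut sw E eqxx.
by apply: sh_eq0 => w sw; rewrite /cut sw E.
Qed.

(** [D = sh _ v] satisfies [D (a g) = D a g + g v * a] and kills [f], as in
    the Weyl algebra; it is locally nilpotent, so characteristic zero forbids
    [r f = e g]. *)
Lemma primitive_no_left_multiple M N f g e r : (0 < M)%N -> (M < N)%N ->
  primitive f -> primitive g ->
  (exists v, size v = M /\ g v <> 0) ->
  (forall w, size w = N ->
     r * f w = e (take (N - M) w) * g (drop (N - M) w)) ->
  forall u, size u = (N - M)%N -> e u = 0.
Proof.
move=> M0 MN fP gP [v [sv gv]] E.
pose D (h : seq I -> R) u := sh u v h.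
pose e' := cut (N - M)%N e; pose g' := cut M g; pose f' := cut N f.
have g'P : primitive g' by apply: cut_primitive.
have E' : wprod M e' g' = fun w => r * f' w.
  apply/funext => w; rewrite /wprod /f' /cut /e' /g' /cut.
  case: (leqP M (size w)) => [Mw|Mw]; last first.
    by rewrite ifF ?mulr0 //; apply/eqP; lia.
  rewrite size_takel ?leq_subr // size_drop subKn // eqxx.
  have [sw|sw] := eqVneq (size w) N; first by rewrite sw eqxx E.
  by rewrite mulr0 ifF ?mul0r //; apply/eqP => ?; move/eqP: sw; apply; lia.
have DE : D (wprod M e' g') = fun=> 0.
  apply/funext => u; rewrite E' /D shM;
    suff -> : sh u v f' = 0 by rewrite mulr0.
  case: u => [|i u]; first by rewrite /= /f' /cut sv ifF //; apply/eqP; lia.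
  by apply: cut_primitive => //; rewrite -size_eq0 sv -lt0n.
have D0 j : iter j D (fun=> 0) = fun=> 0.
  elim: j => //= j ->; apply/funext => u; exact: sh0.
have DW h : D (wprod M h g') = fun u => wprod M (D h) g' u + g v * h u.
  apply/funext => u; rewrite {1}/D sh_wprod ?sv ?leq_addl // leqnn subnn take0.
  by rewrite drop0 sh0r /wprod /g' /cut sv eqxx [_ * h u]mulrC.
have DWj h j : iter j.+1 D (wprod M h g') =
    fun u => wprod M (iter j.+1 D h) g' u + (g v * iter j D h u) *+ j.+1.
  elim: j => [|j IH]; first by rewrite /= DW.
  rewrite iterS IH; apply/funext => u.
  rewrite {1}/D shD -/(D _ u) DW -addrA; congr (_ + _).
  rewrite (_ : sh _ _ _ = (g v * iter j.+1 D h u) *+ j.+1);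
    first by rewrite [RHS]mulrS.
  under eq_sh => w _ do rewrite -mulr_natl mulrA.
  by rewrite shM -mulrA mulr_natl.
(* Applying [D] [j.+1] times to [e' g'] gives zero. If [iter j.+1 D e'] vanishes, only
   [(j + 1) g v * iter j D e'] is left, so the exponent can be lowered. *)
have De j : iter j D e' = (fun=> 0) -> e' = fun=> 0.
  elim: j => // j IH Dj; apply: IH; apply/funext => u.
  have := congr1 (fun h => h u) (DWj e' j).
  rewrite iterSr DE D0 Dj /wprod mul0r if_same add0r => /esym/R0 => H.
  by case: (Rdom H).
suff : e' = fun=> 0.
  move=> e0 u su; have := congr1 (fun h => h u) e0.
  by rewrite /e' /cut su eqxx.
apply: (De N.+1).
(* Each [D] lowers the degree by [M], and [N.+1] steps exceed the degree [N - M] of [e']. *)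
have Dd j u : (size u + j * M != N - M)%N -> iter j D e' u = 0.
  elim: j u => [|j IH] u /=; first by rewrite addn0 /e' /cut => /negbTE ->.
  by move=> H; apply: sh_eq0 => w sw; apply: IH; rewrite sw sv -addnA -mulSn.
apply/funext => u; apply: Dd; apply/eqP;
  have : (N.+1 <= N.+1 * M)%N by rewrite leq_pmulr.
lia.
Qed.
End NoLeftMultiple.
End Shuffle.

(** * Differential operators on functions of words *)

Section DifferentialOperators.
Variables (R : comNzRingType) (n : nat) (D : 'I_n -> R -> R).
Hypothesis DD : forall i, {morph D i : a b / a + b}.
Hypothesis DM : forall i a b, D i (a * b) = a * D i b + D i a * b.

Local Notation M := (seq 'I_n -> R).
Implicit Types (m : M) (O : M -> M).

(** The operator [H_i]: the bracket with [x_i] differentiates the coefficients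
    and multiplies the words by the letter [i] on the left. *)
Definition hop (i : 'I_n) m : M := fun w =>
  D i (m w) + (if w is j :: w' then (if j == i then m w' else 0) else 0).

Arguments hop : simpl never.

Lemma hopD i m1 m2 w : hop i (fun u => m1 u + m2 u) w = hop i m1 w + hop i m2 w.
Proof.
rewrite /hop DD addrACA; congr (_ + _).
by case: w => [|j w]; last case: ifP; rewrite ?addr0.
Qed.

Lemma hopM i r m w : hop i (fun u => r * m u) w = r * hop i m w + D i r * m w.
Proof.
rewrite /hop DM mulrDr addrAC; congr (_ + _ + _).
by case: w => [|j w]; last case: ifP; rewrite ?mulr0.
Qed.

Lemma hop0 i w : hop i (fun=> 0) w = 0.
Proof. by have /eqP := hopD i (fun=> 0) (fun=> 0) w;
  rewrite addr0 -subr_eq subrr => /eqP. Qed.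

Lemma hop_sum i (J : Type) (s : seq J) (F : J -> M) w :
  hop i (fun u => \sum_(j <- s) F j u) w = \sum_(j <- s) hop i (F j) w.
Proof.
elim: s => [|j s IH].
  rewrite big_nil -[RHS](hop0 i w); congr hop; apply/funext => u;
    exact: big_nil.
rewrite big_cons -IH -hopD; congr hop; apply/funext => u; exact: big_cons.
Qed.

(** [O] is a combination of operators [r * H_(i_1) ... H_(i_e)] with [e <= d];
    the recursion splits off the innermost factor. *)
Fixpoint opord d O : Prop :=
  match d with
  | 0 => exists r, forall m w, O m w = r * m w
  | d'.+1 => exists r (Oi : 'I_n -> M -> M), (forall i, opord d' (Oi i)) /\
      forall m w, O m w = r * m w + \sum_i Oi i (hop i m) w
  end.

Lemma opord_mul d r O : opord d O -> opord d (fun m w => r * O m w).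
Proof.
elim: d O => [|d IH] O /=.
  by case=> s E; exists (r * s) => m w; rewrite E mulrA.
case=> s [Oi [HO E]]; exists (r * s), (fun i m w => r * Oi i m w).
by split=> [i|m w]; [exact: IH|rewrite E mulrDr mulrA mulr_sumr].
Qed.

Lemma opord_add d O1 O2 : opord d O1 -> opord d O2 ->
  opord d (fun m w => O1 m w + O2 m w).
Proof.
elim: d O1 O2 => [|d IH] O1 O2 /=.
  by case=> s E [s' E']; exists (s + s') => m w; rewrite E E' mulrDl.
case=> s [Oi [HO E]] [s' [Oi' [HO' E']]].
exists (s + s'), (fun i m w => Oi i m w + Oi' i m w).
split=> [i|m w]; first exact: IH.
by rewrite E E' mulrDl big_split /= addrACA.
Qed.

Lemma opord0 d r : opord d (fun m w => r * m w).
Proof.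
elim: d r => [|d IH] r; first by exists r.
exists r, (fun i m w => 0 * m w); split=> // m w.
by rewrite big1 ?addr0 // => i _; rewrite mul0r.
Qed.

Lemma opord_sum d (J : Type) (s : seq J) (F : J -> M -> M) :
  (forall j, opord d (F j)) -> opord d (fun m w => \sum_(j <- s) F j m w).
Proof.
move=> FO; elim: s => [|j s IH].
  rewrite (_ : (fun m w => _) = fun m w => 0 * m w); first exact: opord0.
  by apply/funext => m; apply/funext => w; rewrite big_nil mul0r.
rewrite (_ : (fun m w => _) = fun m w => F j m w + \sum_(i <- s) F i m w).
  exact: opord_add.
by apply/funext => m; apply/funext => w; rewrite big_cons.
Qed.

Lemma opordW d O : opord d O -> opord d.+1 O.
Proof.
elim: d O => [|d IH] O.
  case=> r E; have -> : O = fun m w => r * m w; last exact: opord0.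
  by apply/funext => m; apply/funext.
case=> r [Oi [HO E]]; exists r, Oi; split=> [i|];
  [exact: (IH _ (HO i))|exact: E].
Qed.

Lemma opord_leq d d' O : (d <= d')%N -> opord d O -> opord d' O.
Proof.
move=> /subnK <-; elim: (d' - d)%N => //= e IH HO.
exact/opordW/IH.
Qed.

Lemma opord_hop d i O : opord d O -> opord d.+1 (fun m => hop i (O m)).
Proof.
elim: d O => [|d IH] O.
  case=> r E; exists (D i r), (fun j m w => (if j == i then r else 0) * m w).
  split=> [j|m w]; first exact: opord0.
  have -> : O m = fun w => r * m w by apply/funext => u; apply: E.
  rewrite hopM addrC (bigD1 i) //= eqxx big1 ?addr0 // => j /negbTE ->.
  by rewrite mul0r.
case=> r [Oi [HO E]].
exists (D i r), (fun j m w => (if j == i then r else 0) * m w + hop i (Oi j m)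
  w).
split=> [j|m w]; first by apply: opord_add;
  [exact: opord0|exact: (IH _ (HO j))].
have -> : O m = fun w => r * m w + \sum_j Oi j (hop j m) w.
  by apply/funext => u; apply: E.
rewrite hopD hopM hop_sum [in RHS]big_split /= addrA; congr (_ + _).
rewrite addrC (bigD1 i) //= eqxx big1 ?addr0 // => j /negbTE ->.
by rewrite mul0r.
Qed.

Lemma opord_additive d O m1 m2 w : opord d O ->
  O (fun u => m1 u + m2 u) w = O m1 w + O m2 w.
Proof.
elim: d O m1 m2 w => [|d IH] O m1 m2 w.
  by case=> r E; rewrite !E mulrDr.
case=> r [Oi [HO E]]; rewrite !E mulrDr addrACA -big_split /=; congr (_ + _).
apply: eq_bigr => i _; rewrite -(IH _ _ _ _ (HO i)).
have -> // : hop i (fun u => m1 u + m2 u) = fun u => hop i m1 u + hop i m2 u.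
by apply/funext => u; apply: hopD.
Qed.

Lemma opord_mulr d r O : opord d O -> opord d (fun m => O (fun w => r * m w)).
Proof.
elim: d r O => [|d IH] r O.
  by case=> s E; exists (s * r) => m w; rewrite E mulrA.
case=> s [Oi [HO E]].
rewrite (_ : (fun m => _) = fun m w =>
  (s * r * m w + \sum_i Oi i (fun u => r * hop i m u) w) +
  \sum_i Oi i (fun u => D i r * m u) w).
  apply: opord_add; last by apply/opordW/opord_sum => i; exact: (IH _ _ (HO i)).
  exists (s * r), (fun i m => Oi i (fun u => r * m u)).
  by split=> // i; exact: (IH _ _ (HO i)).
apply/funext => m; apply/funext => w; rewrite E -addrA -big_split mulrA /=.
congr (_ + _); apply: eq_bigr => i _; rewrite -(opord_additive _ _ _ (HO i)).
have -> // : hop i (fun u => r * m u) = fun u => r * hop i m u + D i r * m u.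
by apply/funext => u; apply: hopM.
Qed.

(** The left Ore condition for powers of [r]. The exponent depends only on [d], so that it serves
    all the coefficients [Oi] simultaneously and can be used repeatedly. *)
Lemma opord_ore d r : exists e, forall O, opord d O ->
  exists2 O', opord d O' & forall m w, r ^+ e * O m w = O' (fun u => r * m u) w.
Proof.
elim: d => [|d [e IH]].
  exists 1%N => O [s E]; exists O; first by exists s.
  by move=> m w; rewrite !E expr1 mulrCA.
(* Two uses of the hypothesis place [r * r] to the right of each [Oi], and
   [r * r H_i = r H_i r - (D i r) r] ends in [r]. The extra factor is the [r] needed on the right of
   the term of order zero. *)
exists (e + e).+1 => O [s [Oi [HO E]]].
have H i : exists O', opord d O' /\
    forall m w, r ^+ (e + e) * Oi i m w = O' (fun u => r * (r * m u)) w.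
  have [O1 HO1 E1] := IH _ (HO i); have [O2 HO2 E2] := IH _ HO1.
  by exists O2; split=> // m w; rewrite exprD -mulrA E1 E2.
have [O' {}H] := fin_all_exists H.
exists (fun m w => (r ^+ (e + e) * s * m w +
    \sum_i r * O' i (fun u => r * hop i m u) w) +
    \sum_i r * O' i (fun u => - D i r * m u) w).
  apply: opord_add; last first.
    by apply/opordW/opord_sum => i; apply/opord_mul/opord_mulr; case: (H i).
  exists (r ^+ (e + e) * s), (fun i m w => r * O' i (fun u => r * m u) w).
  by split=> // i; apply/opord_mul/opord_mulr; case: (H i).
move=> m w; rewrite E mulrDr -addrA -big_split /= exprS; congr (_ + _).
  by ring.
rewrite mulr_sumr; apply: eq_bigr => i _; have [HO' EO'] := H i.
rewrite -mulrA EO' -mulrDr -(opord_additive _ _ _ HO'); congr (_ * _).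
have -> // : (fun u => r * (r * hop i m u)) =
    (fun u => r * hop i (fun v => r * m v) u + - D i r * (r * m u)).
by apply/funext => u; rewrite hopM; ring.
Qed.

Definition symbol d (c : seq 'I_n -> R) O := forall m N,
  (forall w, (N < size w)%N -> m w = 0) ->
  (forall w, (d + N < size w)%N -> O m w = 0) /\
  (forall u v, size u = d -> size v = N -> O m (u ++ v) = c u * m v).

Lemma opord_symbol d O : opord d O -> exists c, symbol d c O /\
  ((forall u, size u = d -> c u = 0) ->
   if d is d'.+1 then opord d' O else forall m w, O m w = 0).
Proof.
elim: d O => [|d IH] O.
  case=> r E; exists (fun=> r); split=> [m N mN|/(_ [::] erefl) r0 m w].
    split=> [w|u v]; first by rewrite E => /mN ->; rewrite mulr0.
    by move=> /size0nil -> _; rewrite E.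
  by rewrite E r0 mul0r.
case=> r [Oi [HO E]].
have [c Hc] := fin_all_exists (fun i => IH (Oi i) (HO i)).
(* The innermost factor [hop i] acts first and so contributes the last letter of the prefix [u];
   hence the reversal. *)
exists (fun u => if rev u is i :: u' then c i (rev u') else 0); split.
  move=> m N mN; have hN i w : (N.+1 < size w)%N -> hop i m w = 0.
    move=> sw; have Dz : D i 0 = 0.
      by have /eqP := DD i 0 0; rewrite addr0 -subr_eq subrr => /eqP.
    rewrite /hop mN ?(ltnW sw) // Dz add0r; case: w sw => //= j w sw.
    by case: ifP => // _; apply: mN.
  split=> [w sw|u v su sv].
    rewrite E mN ?mulr0 ?add0r ?big1 // => [i _|]; last by lia.
    by have [[/(_ _ _ (hN i))[H _] _] _] := (Hc i, tt); apply: H; lia.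
  case/lastP: u su => // u i; rewrite size_rcons => -[su].
  rewrite E mN ?mulr0 ?add0r; last by rewrite size_cat size_rcons; lia.
  rewrite rev_rcons revK (bigD1 i) //= big1 ?addr0 => [|j ji].
    have [[/(_ _ _ (hN i))[_ H] _] _] := (Hc i, tt).
    rewrite -cats1 -catA /= H //= ?sv // /hop eqxx mN /= ?sv //.
    have Dz : D i 0 = 0.
      by have /eqP := DD i 0 0; rewrite addr0 -subr_eq subrr => /eqP.
    by rewrite Dz add0r.
  have [[/(_ _ _ (hN j))[_ H] _] _] := (Hc j, tt).
  rewrite -cats1 -catA /= H //= ?sv // /hop eq_sym (negbTE ji) mN /= ?sv //.
  have Dz : D j 0 = 0.
    by have /eqP := DD j 0 0; rewrite addr0 -subr_eq subrr => /eqP.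
  by rewrite Dz addr0 mulr0.
move=> c0; have ci i u : size u = d -> c i u = 0.
  move=> su; have := c0 (rcons u i); rewrite size_rcons su rev_rcons revK.
  exact.
case: d IH HO Hc {c0} ci => [|d] IH HO Hc ci.
  exists r => m w; rewrite E big1 ?addr0 // => i _.
  by have [_ ->] := Hc i => //; apply: ci.
exists r, Oi; split=> // i; have [_ H] := Hc i; apply: H; exact: ci.
Qed.

Lemma opord_leading d O : opord d O -> (forall m w, O m w = 0) \/
  exists e c, symbol e c O /\ exists2 u, size u = e & c u <> 0.
Proof.
elim: d O => [|d IH] O HO.
  have [c [Hc H]] := opord_symbol HO.
  have [c0|] := pselect (forall u, size u = 0%N -> c u = 0); first by left;
    apply: H.
  by move=> /existsNP[u /not_implyP[su cu]]; right; exists 0%N, c; split=> //;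
    exists u.
have [c [Hc H]] := opord_symbol HO.
have [c0|] := pselect (forall u, size u = d.+1 -> c u = 0); first by apply/IH/H.
by move=> /existsNP[u /not_implyP[su cu]]; right; exists d.+1, c; split=> //;
  exists u.
Qed.

End DifferentialOperators.

(** * Elimination of leading forms *)

Section Elimination.
Variables (R : comNzRingType) (D : 'I_2 -> R -> R).
Hypothesis DD : forall i, {morph D i : a b / a + b}.
Hypothesis DM : forall i a b, D i (a * b) = a * D i b + D i a * b.
Hypothesis Rdom : forall a b : R, a * b = 0 -> a = 0 \/ b = 0.
Hypothesis R0 : forall (a : R) m, a *+ m.+1 = 0 -> a = 0.

Local Notation M := (seq 'I_2 -> R).
Implicit Types (F : M) (O : M -> M).

Definition top N F := (forall w, (N < size w)%N -> F w = 0) /\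
  exists w, size w = N /\ F w <> 0.

Definition bounded F := exists N, forall w, (N < size w)%N -> F w = 0.

Lemma bounded_top F : bounded F -> F = (fun=> 0) \/ exists N, top N F.
Proof.
case=> N; elim: N => [|N IH] FN.
  have [F0|F0] := eqVneq (F [::]) 0.
    by left; apply/funext => -[|i w] //; apply: FN.
  by right; exists 0%N; split=> //; exists [::]; split=> //; apply/eqP.
have [F0|] := pselect (forall w, size w = N.+1 -> F w = 0).
  apply: IH => w; rewrite leq_eqVlt => /orP[/eqP/esym|]; [exact: F0|exact: FN].
move=> /existsNP[w /not_implyP[sw Fw]]; right.
by exists N.+1; split=> //; exists w.
Qed.

Let mul_neq0 (a b : R) : a <> 0 -> b <> 0 -> a * b <> 0.
Proof. by move=> a0 b0 /Rdom[]. Qed.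

Let op0 d O w : opord D d O -> O (fun=> 0) w = 0.
Proof.
move=> HO; have := opord_additive DD (fun=> 0) (fun=> 0) w HO.
have -> : (fun u : seq 'I_2 => (0 : R) + 0) = fun=> 0.
  by apply/funext => u; rewrite addr0.
by move=> /eqP; rewrite -subr_eq subrr => /eqP.
Qed.

(** The leading form of [O i F] is a nonzero product of leading forms, so it can only be the letter
    [i]. As [F] has no constant term, the word [v] in its leading form is then [[:: i]] for both
    [i]. *)
Lemma no_single F (O : 'I_2 -> M -> M) (r : 'I_2 -> R) :
  bounded F -> F [::] = 0 -> (forall i, exists d, opord D d (O i)) ->
  (forall i, r i <> 0) -> (forall i w, O i F w = r i * (w == [:: i])%:R) ->
    False.
Proof.
move=> FB F0 HO r0 E.
have [Fz|[N [FN [v [sv Fv]]]]] := bounded_top FB.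
  have [d HOd] := HO ord0; have := E ord0 [:: ord0].
  by rewrite Fz (op0 _ HOd) eqxx mulr1 => /esym; apply: r0.
have H i : v = [:: i].
  have [d /(opord_leading DD)[Oz|[e [c [Hc [u su cu]]]]]] := HO i.
    by have := E i [:: i]; rewrite Oz eqxx mulr1 => /esym /r0.
  have [_ /(_ u v su sv)] := Hc _ _ FN; rewrite E; case: eqP => [uv _|_].
    case: u uv {su cu} => [//|j u]; case: v sv Fv => [|l v] _ Fv.
      by case: Fv.
    by case: u.
  by rewrite mulr0 => /esym; move: (mul_neq0 cu Fv).
by have := H ord0; rewrite (H ord_max).
Qed.

(** Left independence of the leading forms over the free associative algebra, tested on homogeneous
    coefficients. *)
Definition independent N0 F0 N1 F1 := forall e0 c0 e1 c1,
  (e0 + N0 = e1 + N1)%N ->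
  (forall w, size w = (e0 + N0)%N ->
    c0 (take e0 w) * F0 (drop e0 w) + c1 (take e1 w) * F1 (drop e1 w) = 0) ->
  (forall u, size u = e0 -> c0 u = 0) /\ (forall u, size u = e1 -> c1 u = 0).

Lemma independent_sym N0 F0 N1 F1 :
  independent N0 F0 N1 F1 -> independent N1 F1 N0 F0.
Proof.
move=> H e0 c0 e1 c1 E Hc; have [] := H e1 c1 e0 c0 (esym E); last by split.
by move=> w; rewrite addrC -E; apply: Hc.
Qed.

(** If [N1 > 1], a nonzero [O1 i] yields a leading term of degree at least two, which the right-hand
    side lacks. It would have to cancel against that of [O0 i F0], contrary to independence. So [O1]
    vanishes, and [no_single] applies to [F0]. *)
Lemma independent_bound N0 F0 N1 F1 (O0 O1 : 'I_2 -> M -> M) (r : 'I_2 -> R) :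
  top N0 F0 -> top N1 F1 -> F0 [::] = 0 -> independent N0 F0 N1 F1 ->
  (forall i, exists d, opord D d (O0 i)) ->
  (forall i, exists d, opord D d (O1 i)) ->
  (forall i, r i <> 0) ->
  (forall i w, O0 i F0 w + O1 i F1 w = r i * (w == [:: i])%:R) ->
  (N1 <= 1)%N.
Proof.
move=> T0 T1 F00 ind HO0 HO1 r0 E; rewrite leqNgt; apply/negP => N1gt.
have [F0N [v0 [sv0 Fv0]]] := T0; have [F1N [v1 [sv1 Fv1]]] := T1.
suff O1z i m x : O1 i m x = 0.
  apply: (@no_single F0 O0 r) => //; first by exists N0.
  by move=> i w; rewrite -E O1z addr0.
have RH (u : seq 'I_2) : (1 < size u)%N -> r i * (u == [:: i])%:R = 0.
  by move=> su; case: eqP su => [->|_] //; rewrite mulr0.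
have [d1 /(opord_leading DD)[Oz|[e1 [c1 [Hc1 [u1 su1 cu1]]]]]] := HO1 i.
  exact: Oz.
exfalso; have [d0 /(opord_leading DD)[Oz|[e0 [c0 [Hc0 [u0 su0 cu0]]]]]] := HO0
  i.
  have := E i (u1 ++ v1); rewrite Oz add0r RH; last by rewrite size_cat; lia.
  by have [_ ->] := Hc1 _ _ F1N => //; apply: mul_neq0.
have [H0 K0] := Hc0 _ _ F0N; have [H1 K1] := Hc1 _ _ F1N.
case: (ltngtP (e0 + N0) (e1 + N1)) => [lt|lt|eq].
- have := E i (u1 ++ v1); rewrite H0 ?size_cat ?su1 ?sv1 // add0r K1 //.
  by rewrite RH; [apply: mul_neq0|rewrite size_cat; lia].
- have := E i (u0 ++ v0); rewrite H1 ?size_cat ?su0 ?sv0 // addr0 K0 //.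
  by rewrite RH; [apply: mul_neq0|rewrite size_cat; lia].
have [|_ /(_ u1 su1)] := ind e0 c0 e1 c1 eq; last exact: cu1.
move=> w sw; rewrite -K0 ?size_takel ?size_drop; try by lia.
rewrite -K1 ?size_takel ?size_drop; try by lia.
by rewrite !cat_take_drop E RH // sw; lia.
Qed.

(** Let [N1 < N0]. On words with a fixed prefix [u] of length [e0], a relation says that [c0 u * F0]
    is a left multiple of the leading form of [F1]; by [primitive_no_left_multiple], [c0 u] is
    zero. *)
Lemma primitive_independent N0 F0 N1 F1 : (0 < N0)%N -> (0 < N1)%N ->
  N0 <> N1 -> top N0 F0 -> top N1 F1 -> primitive F0 -> primitive F1 ->
  independent N0 F0 N1 F1.
Proof.
wlog lt : N0 F0 N1 F1 / (N1 < N0)%N.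
  move=> H N0p N1p N01 T0 T1 P0 P1; case: (ltngtP N0 N1) => // lt;
    last exact: H.
  by apply/independent_sym/H => // /esym.
move=> _ N1p _ [_ [v0 [sv0 Fv0]]] [_ [v1 [sv1 Fv1]]] P0 P1 e0 c0 e1 c1 eq E.
have c00 u : size u = e0 -> c0 u = 0.
  move=> su; have K w : size w = N0 -> c0 u * F0 w =
      - c1 (u ++ take (N0 - N1) w) * F1 (drop (N0 - N1) w).
    move=> sw; have := E (u ++ w); rewrite size_cat su sw => /(_ erefl).
    rewrite take_size_cat // drop_size_cat // take_cat drop_cat su.
    have -> : (e1 < e0)%N = false by lia.
    have -> : (e1 - e0 = N0 - N1)%N by lia.
    by rewrite mulNr => /eqP; rewrite addr_eq0 => /eqP.
  have Z := @primitive_no_left_multiple _ _ Rdom R0 N1 N0 F0 F1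
    (fun x => - c1 (u ++ x)) (c0 u) N1p lt P0 P1
    (ex_intro _ v1 (conj sv1 Fv1)) K.
  have := K v0 sv0; rewrite Z ?mul0r; last by rewrite size_takel ?sv0 ?leq_subr.
  by case/Rdom.
split=> // u su; have := E (u ++ v1).
rewrite size_cat su sv1 -eq => /(_ erefl).
rewrite c00 ?mul0r ?add0r; last by rewrite size_takel // size_cat; lia.
by rewrite take_size_cat // drop_size_cat // => /Rdom[].
Qed.

Lemma elimination F0 F1 (O0 O1 : 'I_2 -> M -> M) :
  bounded F0 -> bounded F1 -> primitive F0 -> primitive F1 ->
  F0 [::] = 0 -> F1 [::] = 0 ->
  (forall i, exists d, opord D d (O0 i)) ->
  (forall i, exists d, opord D d (O1 i)) ->
  (forall i w, O0 i F0 w + O1 i F1 w = (w == [:: i])%:R) ->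
  forall w, (1 < size w)%N -> F0 w = 0 /\ F1 w = 0.
Proof.
move=> B0 B1 P0 P1 Z0 Z1 HO0 HO1 E.
have E1 i w : O0 i F0 w + O1 i F1 w = 1 * (w == [:: i])%:R by rewrite mul1r.
have E1' i w : O1 i F1 w + O0 i F0 w = 1 * (w == [:: i])%:R.
  by rewrite addrC E1.
have one0 : (1 : R) <> 0 by apply/eqP/oner_neq0.
have [Fz|[N0 T0]] := bounded_top B0.
  exfalso; apply: (@no_single F1 O1 (fun=> 1)) => // i w.
  by have [d HO] := HO0 i; rewrite -E1 Fz (op0 _ HO) add0r.
have [Fz|[N1 T1]] := bounded_top B1.
  exfalso; apply: (@no_single F0 O0 (fun=> 1)) => // i w.
  by have [d HO] := HO1 i; rewrite -E1 Fz (op0 _ HO) addr0.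
have pos N F : top N F -> F [::] = 0 -> (0 < N)%N.
  by case=> _ [w [sw Fw]] z; rewrite -sw; case: w Fw {sw}.
suff [le0 le1] : (N0 <= 1)%N /\ (N1 <= 1)%N.
  move=> w sw; case: T0 => H0 _; case: T1 => H1 _.
  by split; [apply: H0|apply: H1]; lia.
have [ind|] := pselect (independent N0 F0 N1 F1).
  split; last exact: (independent_bound T0 T1 Z0 ind HO0 HO1 _ E1).
  exact: (independent_bound T1 T0 Z1 (independent_sym ind) HO1 HO0 _ E1').
have [eq|/eqP ne] := eqVneq N0 N1; last first.
  by case; apply: primitive_independent => //;
    [apply: pos T0 _|apply: pos T1 _].
rewrite eq in T0 *; move: T0 T1; set N := N1 => T0 T1 nind.
(* A dependence relation in equal degrees, restricted to words with prefix [u], has the scalar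
   coefficients [c0 u] and [c1 u]. Were [c0] zero throughout, [c1] would be too, because the leading
   form of [F1] is nonzero. *)
have [r [s [r0 rel]]] : exists r s, r <> 0 /\
    forall w, size w = N -> r * F0 w + s * F1 w = 0.
  apply: contrapT => no; apply: nind => e0 c0 e1 c1 /addIn <- Hc.
  have rel u w : size u = e0 -> size w = N -> c0 u * F0 w + c1 u * F1 w = 0.
    move=> su sw; have := Hc (u ++ w); rewrite size_cat su sw => /(_ erefl).
    by rewrite take_size_cat // drop_size_cat.
  have c00 u : size u = e0 -> c0 u = 0.
    move=> su; apply: contrapT => cu; apply: no; exists (c0 u), (c1 u).
    by split=> // w; apply: rel.
  split=> // u su; have [_ [v1 [sv1 Fv1]]] := T1.
  by have := rel u v1 su sv1; rewrite c00 // mul0r add0r => /Rdom[].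
pose F' := fun w => r * F0 w + s * F1 w.
have P' : primitive F'.
  by move=> u v u0 v0; rewrite shD !shM P0 // P1 // !mulr0 addr0.
have F'N w : (N <= size w)%N -> F' w = 0.
  rewrite leq_eqVlt => /orP[/eqP/esym|lt]; first exact: rel.
  by case: T0 T1 => H0 _ [H1 _]; rewrite /F' H0 // H1 // !mulr0 addr0.
have Z' : F' [::] = 0 by rewrite /F' Z0 Z1 !mulr0 addr0.
have : forall i, exists x : nat * nat * (M -> M), opord D x.1.1 x.2 /\
    forall m w, r ^+ x.1.2 * O0 i m w = x.2 (fun u => r * m u) w.
  move=> i; have [d HO] := HO0 i;
    have [e /(_ _ HO)[O' HO' EO']] := opord_ore DD DM d r.
  by exists ((d, e), O').
move=> /fin_all_exists[x Hx].
pose O0' i := (x i).2; pose ri i := r ^+ (x i).1.2.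
(* From [r^e O0 = O0' r] follows [r^e (O0 F0 + O1 F1) = O0' (r F0 + s F1) + (r^e O1 - O0' s) F1], so
   [F'] can replace [F0]. *)
pose O1' i m w := ri i * O1 i m w + O0' i (fun u => - s * m u) w.
have ri0 i : ri i <> 0.
  rewrite /ri; elim: (x i).1.2 => [|e IH]; first by rewrite expr0.
  by rewrite exprS; apply: mul_neq0.
have HO0' i : exists d, opord D d (O0' i) by exists (x i).1.1; case: (Hx i).
have HO1' i : exists d, opord D d (O1' i).
  have [d HO] := HO1 i; have [d' HO'] := HO0' i; exists (maxn d d').
  apply: opord_add; first by apply: opord_mul; apply: opord_leq HO;
    apply: leq_maxl.
  by apply: opord_mulr => //; apply: opord_leq HO'; apply: leq_maxr.
have E' i w : O0' i F' w + O1' i F1 w = ri i * (w == [:: i])%:R.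
  have [d' HO'] := HO0' i.
  rewrite -E mulrDr /O1' addrCA -(opord_additive DD _ _ _ HO') addrC.
  congr (_ + _); have [_ ->] := Hx i; congr (O0' i _ w); apply/funext => u.
  by rewrite /F' mulNr addrK.
have B' : bounded F' by exists N => w /ltnW; apply: F'N.
have [Fz|[N' T']] := bounded_top B'.
  exfalso; apply: (@no_single F1 O1' ri) => // i w.
  by have [d HO] := HO0' i; rewrite -E' Fz (op0 _ HO) add0r.
have N'N : (N' < N)%N.
  by rewrite ltnNge; apply/negP => le; case: T' => _ [w [sw]]; rewrite F'N ?sw.
(* The leading forms of [F'] and [F1] now have different degrees, hence are independent. *)
suff le1 : (N <= 1)%N by [].
apply: (independent_bound T' T1 Z' _ HO0' HO1' ri0 E').
apply: primitive_independent => //; [exact: pos T' Z'|exact: pos T1 Z1|].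
by move=> E0; rewrite E0 ltnn in N'N.
Qed.

End Elimination.

(** * Noncommutative gradients *)

Section Gradient.
Variables (k : fieldType) (n : nat).
Local Notation P := (freePoisson k n).
Local Notation S := (cpoly k (seq (option 'I_n))).
Local Notation tree := (lietree 'I_n).
Implicit Types (w u v : seq 'I_n).

Definition grad (p : P) w : S := pder (wlift w) (phi p).

Definition tree_grad (t : tree) w : S :=
  wlin (tree_comb k t) (fun u => (u == w)%:R).

Lemma wlift_inj : injective (@wlift n).
Proof. by apply: inj_map => i j []. Qed.

Lemma pder_tree (t : tree) s : pder s (phi (tree_eval (fpvar k) t)) =
  wlin (tree_comb k t) (fun u => (wlift u == s)%:R).
Proof.
have d := pder_derivation k s; rewrite phi_tree.
rewrite (wlin_linear (F := pder s)); last first.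
  by move=> a p q; case: (d) => _ -> _; rewrite (derivationZ d).
by congr wlin; apply/funext => u /=; rewrite pder_var.
Qed.

Lemma grad_tree (t : tree) : grad (tree_eval (fpvar k) t) = tree_grad t.
Proof.
apply/funext => w; rewrite /grad pder_tree; congr wlin; apply/funext => u.
by rewrite (inj_eq wlift_inj).
Qed.

Lemma grad_const c w : grad c%:A w = 0.
Proof. by rewrite /grad phi_const; apply: der_const. Qed.

Lemma gradD p q w : grad (p + q) w = grad p w + grad q w.
Proof. by rewrite /grad rmorphD; apply: derD. Qed.

Lemma gradM p q w : grad (p * q) w = phi p * grad q w + phi q * grad p w.
Proof. by rewrite /grad rmorphM [phi q * _]mulrC; apply: derM. Qed.

Lemma tree_grad_homog (t : tree) : homog (lsize t) (tree_grad t).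
Proof.
move=> w sw; rewrite /tree_grad (@eq_wlin_tree _ _ _ _ _ (fun=> 0)).
  by rewrite /wlin big1 // => c _; rewrite scaler0.
move=> u su; have [E|//] := eqVneq u w.
by move: sw; rewrite -E su eqxx.
Qed.

(** [tree_grad t] lists the coefficients of the Lie monomial [t] on words, so a bracket becomes a
    commutator. *)
Lemma tree_grad_node (l r : tree) : tree_grad (Node l r) = fun w =>
  wprod (lsize r) (tree_grad l) (tree_grad r) w -
  wprod (lsize l) (tree_grad r) (tree_grad l) w.
Proof.
apply/funext => w; rewrite /tree_grad wlin_node.
have E (s t : tree) : wlin (tree_comb k s) (fun u => wlin (tree_comb k t)
      (fun v => (u ++ v == w)%:R)) = wprod (lsize t) (tree_grad s) (tree_grad
        t) w.
  rewrite /wprod; case: leqP => [le|lt].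
    rewrite /tree_grad {2}/wlin mulr_suml; apply: eq_bigr => c _.
    rewrite -scalerAl; congr (_ *: _);
      rewrite /wlin mulr_sumr big_seq [RHS]big_seq.
    apply: eq_bigr => b bt; rewrite -scalerAr; congr (_ *: _).
    have /eqP sb := allP (tree_comb_size k t) _ bt.
    rewrite -natrM mulnb; congr (nat_of_bool _)%:R;
      apply/eqP/andP => [<-|[/eqP-> /eqP->]].
      by rewrite size_cat sb addnK take_size_cat // drop_size_cat.
    exact: cat_take_drop.
  rewrite /wlin big1 // => c _; rewrite big_seq big1 ?scaler0 // => b bt.
  have /eqP sb := allP (tree_comb_size k t) _ bt.
  by case: eqP => [E|_]; rewrite ?scaler0 //; move: lt;
    rewrite -E size_cat sb; lia.
by rewrite !E.
Qed.

Lemma tree_grad_primitive (t : tree) : primitive (tree_grad t).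
Proof.
elim: t => [i|l IHl r IHr].
  move=> u v u0 v0; apply: sh_eq0 => w sw; apply: tree_grad_homog.
  by move: u0 v0; rewrite sw /= -!size_eq0;
    case: (size u) (size v) => [|a] [|b] // _ _; rewrite addnS.
rewrite tree_grad_node.
apply: primitive_comm (lsize_gt0 l) (lsize_gt0 r) _ _ IHl IHr;
  exact: tree_grad_homog.
Qed.

(** Gradients are combinations, with coefficients in [S], of those of Lie monomials, and primitivity
    is linear over [S]. *)
Lemma grad_primitive p : primitive (grad p).
Proof.
elim: (freePoisson_lie_generated p) => {p} [t|c|p q _ Gp _ Gq|p q _ Gp _ Gq].
- by rewrite grad_tree; apply: tree_grad_primitive.
- by move=> u v _ _; apply: sh_eq0 => w _; apply: grad_const.
- move=> u v u0 v0; rewrite (eq_sh (e2 := fun w => grad p w + grad q w)).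
    by rewrite shD Gp // Gq // addr0.
  by move=> w _; apply: gradD.
- move=> u v u0 v0.
  rewrite (eq_sh (e2 := fun w => phi p * grad q w + phi q * grad p w)).
    by rewrite shD !shM Gp // Gq // !mulr0 addr0.
  by move=> w _; apply: gradM.
Qed.

Lemma grad_bounded (p : P) : exists N, forall w, (N < size w)%N -> grad p w = 0.
Proof.
elim: (freePoisson_lie_generated p) => {p} [t|c|p q _ [N Gp] _ [N' Gq]|p q _
  [N Gp] _ [N' Gq]].
- exists (lsize t) => w sw; rewrite grad_tree tree_grad_homog //.
  by rewrite neq_ltn sw orbT.
- by exists 0%N => w _; apply: grad_const.
- exists (maxn N N') => w; rewrite gtn_max => /andP[a b].
  by rewrite gradD Gp // Gq // addr0.
- exists (maxn N N') => w; rewrite gtn_max => /andP[a b].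
  by rewrite gradM Gp // Gq // !mulr0 addr0.
Qed.

(** Only nonempty words without [None] occur as variables in [phi p]. *)
Lemma pder_phi_eq0 s (p : P) : (forall w, w != [::] -> s != wlift w) ->
  pder s (phi p) = 0.
Proof.
move=> sN.
elim: (freePoisson_lie_generated p) => {p} [t|c|p q _ Gp _ Gq|p q _ Gp _ Gq].
- rewrite pder_tree (@eq_wlin_tree _ _ _ _ _ (fun=> 0)).
    by rewrite /wlin big1 // => c _; rewrite scaler0.
  move=> u su; rewrite eq_sym (negbTE (sN u _)) //.
  by rewrite -size_eq0 su -lt0n lsize_gt0.
- by rewrite phi_const; apply: der_const.
- by rewrite rmorphD [LHS]derD [X in X + _]Gp [X in _ + X]Gq addr0.
- by rewrite rmorphM [LHS]derM [X in _ * X + _]Gq [X in _ + X * _]Gp mulr0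
  mul0r addr0.
Qed.

(** Words that end with the extra letter [None]. The part of [{p, None}] that
    is linear in them is the gradient of [p]; they stand for the basis of a left
    module over the enveloping algebra. *)
Definition marked w : seq (option 'I_n) := rcons (wlift w) None.

Lemma None_wlift w : None \notin wlift w.
Proof. by apply/mapP => -[]. Qed.

Lemma pder_marked_phi w (p : P) : pder (marked w) (phi p) = 0.
Proof.
apply: pder_phi_eq0 => u _; apply/eqP => E; have := None_wlift u.
by rewrite -E /marked mem_rcons inE eqxx.
Qed.

Definition mgrad (q : S) w : S := pder (marked w) q.

Definition hamx (i : 'I_n) : S -> S := ham [:: Some i].

(** The commutator of the derivations [pder (marked w)] and [hamx i] is a derivation, so it is
    computed on variables. There [v ++ [:: Some i]] is never marked, which leaves multiplication by
    [i] on the left. *)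
Lemma mgrad_ham i q w : mgrad (hamx i q) w = hop hamx i (mgrad q) w.
Proof.
rewrite /hop /mgrad; set s := marked w.
have dh := ham_derivation k [:: Some i]; have ds := pder_derivation k s.
pose T (q : S) : S := if w is j :: w' then (if j == i then pder (marked w') q
  else 0) else 0.
have dT : derivation T.
  rewrite /T; case: w {s ds T} => [|j w]; first exact: derivation_zero.
  by case: eqP => _; [exact: pder_derivation|exact: derivation_zero].
apply/eqP; rewrite addrC -subr_eq; apply/eqP; move: q.
apply: (derivation_ext (derivation_comm ds dh) dT) => v.
rewrite ham_var (derivationB ds) !pder_var.
have -> : ham [:: Some i] ((v == s)%:R : S) = 0.
  case: (v == s) => /=; last by rewrite (derivation0 dh).
  by rewrite mulr1n -[1]scale1r; case: dh.
have -> : (v ++ [:: Some i] == s) = false.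
  apply/negbTE/eqP => /(congr1 (last None)).
  by rewrite last_cat /= /s /marked last_rcons.
rewrite !subr0 /T /s /marked; case: w {s ds T dT} => [|j w] /=.
  by case: v => [|a v]; rewrite ?eqseq_cons //= andbC; case: eqP => // -[].
rewrite eqseq_cons; have -> : (Some i == Some j) = (j == i) by rewrite eq_sym.
by case: eqP => _; rewrite ?pder_var.
Qed.

Definition marker : S := tvar k [:: None].

(** On a word [u] the bracket is [u None - None u], of which only the first term can be marked.
    Products follow by the Leibniz rule, as [phi p] contains no marked word. *)
Lemma mgrad_marker (p : P) w : mgrad (pbr (phi p) marker) w = grad p w.
Proof.
have d := pder_derivation k (marked w); have dl := wbr_derivationl marker.
rewrite /mgrad.
elim: (freePoisson_lie_generated p) => {p} [t|c|p q _ Gp _ Gq|p q _ Gp _ Gq].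
- rewrite grad_tree phi_tree (wlin_linear (F := fun p => pbr p marker));
  last first.
    exact: pbr_linearl.
  rewrite (wlin_linear (F := pder (marked w))); last first.
    by move=> a p q; case: (d) => _ -> _; rewrite (derivationZ d).
  apply: eq_wlin_tree => u su /=.
  rewrite [pbr _ _]wbr_varl ham_var (derivationB d) !pder_var /marked cats1.
  have -> : (rcons (wlift u) None == rcons (wlift w) None) = (u == w).
    by rewrite eqseq_rcons eqxx andbT (inj_eq wlift_inj).
  have -> : (([:: None] ++ wlift u) == rcons (wlift w) None) = false;
    last exact: subr0.
  case: w {d} => [|i w] /=; last by rewrite eqseq_cons.
  by case: u su => // su; have := lsize_gt0 t; rewrite -su.
- rewrite grad_const phi_const (_ : pbr _ _ = 0) ?(derivation0 d) //.
  by case: dl => H _ _; apply: H.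
- rewrite rmorphD pbrDl gradD -Gp -Gq; exact: derD.
- rewrite rmorphM gradM -Gp -Gq.
  have -> : pbr (phi p * phi q) marker =
      phi p * pbr (phi q) marker + phi q * pbr (phi p) marker.
    by case: dl => _ _ /(_ (phi p) (phi q)); rewrite [X in _ + X]mulrC.
  by case: d => _ -> M; rewrite !M !pder_marked_phi !mul0r !addr0.
Qed.

End Gradient.

(** * The action of the enveloping algebra *)

Section EnvelopeAction.
Variables (k : fieldType) (n : nat).
Local Notation P := (freePoisson k n).
Local Notation S := (cpoly k (seq (option 'I_n))).
Implicit Types (F : S -> S).

Lemma phi_relations : env_relations
  (fun a : P => lmult (phi a)) (fun a : P => lham (phi a)).
Proof.
have [ml hl mM hB hM mB m1] := action_relations S.
split=> [c a b|c a b|a b|a b|a b|a b|].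
- by rewrite phi_linear ml.
- by rewrite phi_linear hl.
- by rewrite rmorphM mM.
- by rewrite phi_pbr hB.
- by rewrite rmorphM hM.
- by rewrite phi_pbr mB.
- by rewrite rmorph1 m1.
Qed.

Definition act (u : envelope P) : lend S :=
  eeval (fun a : P => lmult (phi a)) (fun a : P => lham (phi a)) u.

(** The part of [F q] linear in marked words depends only on that of [q], through an operator of
    finite order. *)
Definition represented F := exists d O, opord (@hamx k n) d O /\
  forall q, mgrad (F q) = O (mgrad q).

Lemma hamxD i : {morph @hamx k n i : a b / a + b}.
Proof. by case: (@ham_derivation k _ [:: Some i]). Qed.

Lemma hamxM i a b : hamx i (a * b) = a * hamx i b + hamx i a * b :> S.
Proof. by case: (@ham_derivation k _ [:: Some i]) => _ _ H; apply: H. Qed.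

Lemma represented_id : represented id.
Proof.
exists 0%N, id; split=> //; exists 1 => m w; by rewrite mul1r.
Qed.

Lemma represented_add F1 F2 : represented F1 -> represented F2 ->
  represented (fun q => F1 q + F2 q).
Proof.
move=> [d1 [O1 [HO1 E1]]] [d2 [O2 [HO2 E2]]].
exists (maxn d1 d2), (fun m w => O1 m w + O2 m w); split.
  apply: opord_add; first by apply: opord_leq HO1; apply: leq_maxl.
  by apply: opord_leq HO2; apply: leq_maxr.
by move=> q; rewrite -E1 -E2; apply/funext => w; apply: derD.
Qed.

Lemma represented_mul (a : P) F : represented F ->
  represented (fun q => phi a * F q).
Proof.
move=> [d [O [HO E]]]; exists d, (fun m w => phi a * O m w).
split; first exact: opord_mul.
move=> q; rewrite -E; apply/funext => w; rewrite /mgrad.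
by rewrite [LHS]derM [X in _ + X * _]pder_marked_phi mul0r addr0.
Qed.

Lemma represented_opp F : represented F -> represented (fun q => - F q).
Proof.
move=> RF; have := represented_mul (-1) RF.
rewrite (_ : (fun q => _) = fun q => - F q) //.
by apply/funext => q; rewrite rmorphN rmorph1 mulN1r.
Qed.

Lemma represented_pbr (a : P) F : represented F ->
  represented (fun q => pbr (phi a) (F q)).
Proof.
elim/freePoisson_ind: a F => [i|c|a b Ra Rb|a b Ra Rb|a b Ra Rb] F RF.
- have [d [O [HO E]]] := RF; exists d.+1, (fun m => hop (@hamx k n) i (O m)).
  split; first exact: opord_hop (hamxD) (hamxM) _ _ _ HO.
  move=> q; rewrite -E; apply/funext => w.
  by rewrite /phi fpeval_var [pbr _ _]wbr_varl -mgrad_ham.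
- have := represented_mul 0 RF.
  rewrite (_ : (fun q => _) = fun q => pbr (phi c%:A) (F q)) //.
  by apply/funext => q; rewrite rmorph0 mul0r phi_const pbrC pbr_const oppr0.
- have := represented_add (Ra _ RF) (Rb _ RF).
  rewrite (_ : (fun q => _) = fun q => pbr (phi (a + b)) (F q)) //.
  by apply/funext => q; rewrite rmorphD pbrDl.
- have := represented_add (represented_mul b (Ra _ RF)) (represented_mul a (Rb
  _ RF)).
  rewrite (_ : (fun q => _) = fun q => pbr (phi (a * b)) (F q)) //.
  apply/funext => q; have := env_hM phi_relations a b.
  by move/(congr1 (fun f : lend S => f (F q))) => /= ->.
- have := represented_add (Ra _ (Rb _ RF)) (represented_opp (Rb _ (Ra _ RF))).
  rewrite (_ : (fun q => _) = fun q => pbr (phi (pbr a b)) (F q)) //.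
  apply/funext => q; have := env_hB phi_relations a b.
  by move/(congr1 (fun f : lend S => f (F q))) => /= ->.
Qed.

(** With an arbitrary represented [F] inside, the case of a product is two successive uses of the
    induction hypothesis. *)
Lemma represented_act u F : represented F -> represented (fun q => act u (F q)).
Proof.
have [ul [u1 uM] um uh] := eeval_universal phi_relations.
elim/envelope_ind: u F => [a|a|c|u v Ru Rv|u v Ru Rv] F RF.
- rewrite /act um; exact: represented_mul.
- rewrite /act uh; exact: represented_pbr.
- have := represented_mul c%:A RF.
  rewrite (_ : (fun q => _) = fun q => act c%:A (F q)) //.
  apply/funext => q; rewrite phi_const mulr_algl /act.
  have := ul (-1) 0 0; rewrite scaler0 addr0 scaleN1r addNr => act0.
  by have := ul c 1 0; rewrite addr0 act0 addr0 u1 => ->.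
- have := represented_add (Ru _ RF) (Rv _ RF).
  rewrite (_ : (fun q => _) = fun q => act (u + v) (F q)) //.
  by apply/funext => q; have := ul 1 u v; rewrite /act !scale1r => ->.
- have := Ru _ (Rv _ RF).
  rewrite (_ : (fun q => _) = fun q => act (u * v) (F q)) //.
  by apply/funext => q; rewrite /act uM.
Qed.

End EnvelopeAction.

(** * From the Jacobian matrix to the gradients *)

Theorem theorem6 (k : fieldType) (psi : {lrmorphism freePoisson k 2 -> freePoisson k 2}) :
  [pchar k] =i pred0 ->
  poisson_morphism psi ->
  invertible_mx (jacobian psi) ->
  in_polynomials (psi (fpvar k ord0)) /\ in_polynomials (psi (fpvar k ord_max)).
Proof.
move=> k0 _ [B [_ BJ]].
set f0 := psi _; set f1 := psi _.
(* Row [i] of [B *m jacobian psi = 1%:M], read on the elements [h_(x_l)]. *)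
have rel (i : 'I_2) : B i ord0 * env_h f0 + B i ord_max * env_h f1 =
    env_h (fpvar k i).
  have {}BJ l : \sum_j B i j * fox (psi (fpvar k j)) l = (i == l)%:R.
    have /matrixP/(_ i l) := BJ; rewrite !mxE => <-.
    by apply: eq_bigr => j _; rewrite mxE.
  transitivity (\sum_j B i j * env_h (psi (fpvar k j))).
    rewrite big_ord_recl big_ord1;
      congr (_ * _ + B i _ * env_h (psi (fpvar k _))) => //;
      exact: val_inj.
  under eq_bigr => j _ do rewrite foxP mulr_sumr.
  rewrite exchange_big /=.
  have {}BJ l : \sum_j B i j * (fox (psi (fpvar k j)) l * env_h (fpvar k l)) =
      (i == l)%:R * env_h (fpvar k l).
    by rewrite -BJ mulr_suml; apply: eq_bigr => j _; rewrite mulrA.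
  under eq_bigr => l _ do rewrite BJ.
  rewrite (bigD1 i) //= eqxx mul1r big1 ?addr0 // => l.
  by rewrite eq_sym => /negbTE ->; rewrite mul0r.
have [ul [_ uM] _ uh] := eeval_universal (phi_relations k 2).
(* The relation is applied to the marker, since the marked part of [{p, None}] is the gradient of
   [p]. *)
have relS (i : 'I_2) : act (B i ord0) (pbr (phi f0) (marker k 2)) +
    act (B i ord_max) (pbr (phi f1) (marker k 2)) =
    pbr (phi (fpvar k i)) (marker k 2).
  have := congr1 (fun u => act u (marker k 2)) (rel i).
  have := ul 1 (B i ord0 * env_h f0) (B i ord_max * env_h f1).
  by rewrite /act !scale1r => -> /=; rewrite !uM !uh /=.
have Rep (j i : 'I_2) := represented_act (B i j) (represented_id k 2).
pose O j i := sval (cid (svalP (cid (Rep j i)))).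
have HO j i : exists d, opord (@hamx k 2) d (O j i).
  by case: (svalP (cid (svalP (cid (Rep j i))))) => H _; eexists; exact: H.
have EO j i q : mgrad (act (B i j) q) = O j i (mgrad q).
  by case: (svalP (cid (svalP (cid (Rep j i))))).
have gm (p : freePoisson k 2) : mgrad (pbr (phi p) (marker k 2)) = grad p.
  by apply/funext => w; apply: mgrad_marker.
have main := elimination (@hamxD k 2) (@hamxM k 2) (@cpoly_mulf_eq0 k _)
  (@cpoly_mulrn_eq0 k _ k0) (grad_bounded f0) (grad_bounded f1)
  (grad_primitive f0) (grad_primitive f1) _ _ (HO ord0) (HO ord_max).
have Z (p : freePoisson k 2) : grad p [::] = 0.
  apply: pder_phi_eq0 => w; apply: contraNN => /eqP /=.
  by case: w.
have {}main w : (1 < size w)%N -> grad f0 w = 0 /\ grad f1 w = 0.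
  apply: main => [||i {}w]; [exact: Z|exact: Z|].
  rewrite -!gm -!EO; transitivity (grad (fpvar k i) w); last first.
    have := congr1 (fun F => F w) (grad_tree k (Leaf i)) => /= ->.
    by rewrite /tree_grad wlin_leaf eq_sym.
  by rewrite -gm -relS; apply/esym/derD.
have fin (p : freePoisson k 2) : (forall w, (1 < size w)%N -> grad p w = 0) ->
    in_polynomials p.
  move=> Hp.
  (* Words containing [None] and the empty word never occur in [phi p], and [Hp] excludes those of
     length at least two; single letters remain. *)
  have dN (v : seq (option 'I_2)) : None \in v -> pder v (phi p) = 0.
    move=> vN; apply: pder_phi_eq0 => w _; apply/eqP => E.
    by have := None_wlift w; rewrite -E vN.
  apply: in_polynomials_retract => // v sv.
  have [vN|vN] := boolP (None \in v); first exact: dN.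
  have [w Ew] : exists w, v = wlift w.
    elim: v vN {sv} => [|[i|] v IH]; first by exists [::].
      by rewrite inE => /IH[w ->]; exists (i :: w).
    by rewrite inE eqxx.
  case: w Ew => [|i w] Ew; first by rewrite Ew; apply: Z.
  rewrite Ew; apply: Hp; move: sv; rewrite Ew /=.
  by rewrite size_map ltnS lt0n eqSS.
by split; apply: fin => w /main[].
Qed.
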